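(* Let $\lambda$ and $\mathbf{a}=(a_\ell)_{\ell\ge0}$, $\mathbf{b}=(b_{\ell,\ell'})$, $\mathbf{c}=(c_{\ell,\ell'})$, $\mathbf{d}=(d_{\ell,\ell'})$ ($\ell,\ell'\ge0$), $\mathbf{e}=(e_\ell)_{\ell\ge0}$, $\mathbf{f}=(f_\ell)_{\ell\ge0}$ be commuting indeterminates, and for $n\ge0$ let \[ \widehat{Q}_n=\sum_{\sigma\in\mathfrak{D}_{2n}}\lambda^{\mathrm{cyc}(\sigma)}\prod_{i\in\mathrm{Cval}(\sigma)}a_{\mathrm{ucross}(i,\sigma)+\mathrm{unest}(i,\sigma)}\prod_{i\in\mathrm{Cpeak}(\sigma)}b_{\mathrm{lcross}(i,\sigma),\mathrm{lnest}(i,\sigma)}\prod_{i\in\mathrm{Cdfall}(\sigma)}c_{\mathrm{lcross}(i,\sigma),\mathrm{lnest}(i,\sigma)}\prod_{i\in\mathrm{Cdrise}(\sigma)}d_{\mathrm{ucross}(i,\sigma),\mathrm{unest}(i,\sigma)}\prod_{i\in\mathrm{Evenfix}(\sigma)}e_{\mathrm{psnest}(i,\sigma)}\prod_{i\in\mathrm{Oddfix}(\sigma)}f_{\mathrm{psnest}(i,\sigma)}. \] Then \[ \sum_{n\ge0}\widehat{Q}_nt^n=\cfrac{1}{1-\delta_1t-\cfrac{\alpha_1t}{1-\delta_2t-\cfrac{\alpha_2t}{1-\cdots}}} \] as formal power series in $t$, where for $k\ge1$: $\alpha_{2k-1}=(\lambda+k-1)\,a_{k-1}\sum_{\xi=0}^{k-1}b_{k-1-\xi,\xi}$,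 $\alpha_{2k}=\big(\lambda e_k+\sum_{\xi=0}^{k-1}c_{k-1-\xi,\xi}\big)\big(\lambda f_k+\sum_{\xi=0}^{k-1}d_{k-1-\xi,\xi}\big)$, $\delta_1=\lambda^2e_0f_0$ and $\delta_n=0$ for $n\ge2$.
   Context: A D-permutation of $[2n]$ is a permutation $\sigma$ with $\sigma(2k-1)\ge2k-1$ and $\sigma(2k)\le 2k$ for all $k$; $\mathfrak{D}_{2n}$ is their set. $\mathrm{Cpeak}(\sigma)=\{i:\sigma^{-1}(i)<i>\sigma(i)\}$, $\mathrm{Cval}(\sigma)=\{i:\sigma^{-1}(i)>i<\sigma(i)\}$, $\mathrm{Cdrise}(\sigma)=\{i:\sigma^{-1}(i)<i<\sigma(i)\}$, $\mathrm{Cdfall}(\sigma)=\{i:\sigma^{-1}(i)>i>\sigma(i)\}$, $\mathrm{Evenfix}(\sigma)$ ($\mathrm{Oddfix}(\sigma)$) = set of even (odd) $i$ with $\sigma(i)=i$. $\mathrm{cyc}$ = number of cycles (fixed points included). $\mathrm{ucross}(j,\sigma)=\#\{(i,k,l):i<j<k<l,\ k=\sigma(i),\ l=\sigma(j)\}$, $\mathrm{unest}(j,\sigma)=\#\{(i,k,l):i<j<k<l,\ k=\sigma(j),\ l=\sigma(i)\}$, $\mathrm{lcross}(k,\sigma)=\#\{(i,j,l):i<j<k<l,\ i=\sigma(k),\ j=\sigma(l)\}$, $\mathrm{lnest}(k,\sigma)=\#\{(i,j,l):i<j<k<l,\ i=\sigma(l),\ j=\sigma(k)\}$, and for a fixed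 point $i$, $\mathrm{psnest}(i,\sigma)=\#\{j<i:\sigma(j)>i\}$. *)

(* Defs.v *)
From HB Require Import structures.
From mathcomp Require Import all_boot all_order all_algebra all_fingroup.
Set Implicit Arguments.
Unset Strict Implicit.
Unset Printing Implicit Defensive.
Import GRing.Theory.

Section DPermutations.

Variable m : nat.
Implicit Types (s : {perm 'I_m}) (i j k l : 'I_m).

(* The ordinal i : 'I_m stands for the element i + 1 of [m] = {1, ..., m}.
   The shift preserves the order and only matters for parities. *)
Definition label i : nat := i.+1.

Definition Dperm s : bool :=
  [forall i, if odd (label i) then i <= s i else s i <= i].

(* (s^-1)%g is the inverse permutation. *)
Definition Cpeak s : {set 'I_m} := [set i : 'I_m | ((s^-1)%g i < i) && (s i < i)].
Definition Cval s : {set 'I_m} := [set i : 'I_m | (i < (s^-1)%g i) && (i < s i)].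
Definition Cdrise s : {set 'I_m} := [set i : 'I_m | ((s^-1)%g i < i) && (i < s i)].
Definition Cdfall s : {set 'I_m} := [set i : 'I_m | (i < (s^-1)%g i) && (s i < i)].
Definition Evenfix s : {set 'I_m} := [set i : 'I_m | ~~ odd (label i) && (s i == i)].
Definition Oddfix s : {set 'I_m} := [set i : 'I_m | odd (label i) && (s i == i)].

(* porbits includes the singleton orbits of the fixed points. *)
Definition cyc s : nat := #|porbits s|.

Definition quadr i j k l : bool := [&& i < j, j < k & k < l].

Definition ucross j s : nat :=
  #|[set t : 'I_m * 'I_m * 'I_m | let: (i, k, l) := t in
      [&& quadr i j k l, k == s i & l == s j]]|.
Definition unest j s : nat :=
  #|[set t : 'I_m * 'I_m * 'I_m | let: (i, k, l) := t in
      [&& quadr i j k l, k == s j & l == s i]]|.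
Definition lcross k s : nat :=
  #|[set t : 'I_m * 'I_m * 'I_m | let: (i, j, l) := t in
      [&& quadr i j k l, i == s k & j == s l]]|.
Definition lnest k s : nat :=
  #|[set t : 'I_m * 'I_m * 'I_m | let: (i, j, l) := t in
      [&& quadr i j k l, i == s l & j == s k]]|.
Definition psnest i s : nat := #|[set j : 'I_m | (j < i) && (i < s j)]|.

End DPermutations.

Local Open Scope ring_scope.

Definition Qhat (R : comNzRingType) (lam : R) (a : nat -> R)
    (b c d : nat -> nat -> R) (e f : nat -> R) (n : nat) : R :=
  \sum_(s : {perm 'I_(2 * n)} | Dperm s)
    lam ^+ cyc s
    * (\prod_(i in Cval s) a (ucross i s + unest i s)%N)
    * (\prod_(i in Cpeak s) b (lcross i s) (lnest i s))
    * (\prod_(i in Cdfall s) c (lcross i s) (lnest i s))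
    * (\prod_(i in Cdrise s) d (ucross i s) (unest i s))
    * (\prod_(i in Evenfix s) e (psnest i s))
    * (\prod_(i in Oddfix s) f (psnest i s)).

Section PowerSeries.

Variable R : comNzRingType.

(* The formal power series \sum_n u_n t^n is the function n |-> u_n. *)
Definition fps : Type := nat -> R.
Implicit Types u v : fps.

Definition fps_one : fps := fun n => (n == 0%N)%:R.
Definition fps_sub u v : fps := fun n => u n - v n.
Definition fps_scale (x : R) u : fps := fun n => x * u n.
Definition fps_mul u v : fps := fun n => \sum_(i < n.+1) u i * v (n - i)%N.
Definition fps_t : fps := fun n => (n == 1%N)%:R.
Definition fps_exp u (k : nat) : fps := iter k (fps_mul u) fps_one.

(* 1 / u = \sum_(k >= 0) (1 - u)^k; meaningful when u has constant term 1,
   in which case (1 - u)^k does not contribute to degrees below k. *)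
Definition fps_inv u : fps :=
  fun n => \sum_(k < n.+1) fps_exp (fps_sub fps_one u) k n.

Lemma fps_exp_lt u k n : u 0%N = 0 -> (n < k)%N -> fps_exp u k n = 0.
Proof.
move=> u0; elim: k n => // k IHk n ltnk; rewrite /= /fps_mul big1 // => i _.
case: (posnP i) => [->|i_gt0]; first by rewrite u0 mul0r.
rewrite IHk ?mulr0 //.
have lein : (i <= n)%N by rewrite -ltnS.
by apply: leq_trans (_ : n <= k)%N => //; rewrite ltn_subrL i_gt0 (leq_trans i_gt0 lein).
Qed.

Lemma fps_mulV u n : u 0%N = 1 -> fps_mul u (fps_inv u) n = fps_one n.
Proof.
move=> u1; rewrite /fps_mul /fps_inv; set h := fps_sub fps_one u.
have h0 : h 0%N = 0 by rewrite /h /fps_sub u1 subrr.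
have uE i : u i = fps_one i - h i by rewrite /h /fps_sub subKr.
have E (i : 'I_n.+1) : \sum_(k < (n - i).+1) fps_exp h k (n - i)%N
    = \sum_(k < n.+1) fps_exp h k (n - i)%N.
  rewrite -!(big_mkord xpredT (fun k => fps_exp h k (n - i)%N)).
  rewrite [RHS](@big_cat_nat _ _ _ (n - i).+1) ?ltnS ?leq_subr //=.
  rewrite [X in _ = _ + X]big_nat [X in _ = _ + X]big1 ?addr0 // => k /andP[ltk _].
  exact: fps_exp_lt.
under eq_bigr => i _ do rewrite E mulr_sumr.
rewrite exchange_big /=.
have T k : \sum_(i < n.+1) u i * fps_exp h k (n - i)%N
    = fps_exp h k n - fps_exp h k.+1 n.
  under eq_bigr => i _ do rewrite uE mulrBl.
  rewrite sumrB; congr (_ - _).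
  rewrite big_ord_recl /fps_one eqxx mul1r subn0 big1 ?addr0 // => i _.
  by rewrite mul0r.
under eq_bigr => k _ do rewrite T.
rewrite -(big_mkord xpredT (fun k => fps_exp h k n - fps_exp h k.+1 n)).
under eq_bigr => k _ do rewrite -opprB.
rewrite sumrN telescope_sumr // opprB [fps_exp h n.+1 n]fps_exp_lt // subr0 //.
Qed.

(* The truncation to depth N (alpha_(k+N) replaced by 0) of the fraction
     1 / (1 - delta_k t - alpha_k t / (1 - delta_(k+1) t - ...)). *)
Fixpoint Tfrac_trunc (delta alpha : nat -> R) (N k : nat) : fps :=
  let den := fps_sub fps_one (fps_scale (delta k) fps_t) in
  if N is N'.+1 then
    fps_inv (fps_sub den (fps_mul (fps_scale (alpha k) fps_t)
                                  (Tfrac_trunc delta alpha N' k.+1)))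
  else fps_inv den.

Lemma Tfrac_trunc_mul (delta alpha : nat -> R) (N k n : nat) :
  fps_mul
    (fps_sub (fps_sub fps_one (fps_scale (delta k) fps_t))
       (fps_mul (fps_scale (alpha k) fps_t) (Tfrac_trunc delta alpha N k.+1)))
    (Tfrac_trunc delta alpha N.+1 k) n = fps_one n.
Proof.
rewrite [Tfrac_trunc _ _ N.+1 _]/= fps_mulV //.
rewrite /fps_sub /fps_scale /fps_mul big_ord_recl big_ord0 /fps_one /fps_t /=.
by rewrite !mulr0 mul0r addr0 !subr0.
Qed.

(* u equals the infinite continued fraction
     1 / (1 - delta_1 t - alpha_1 t / (1 - delta_2 t - ...)),
   that is, the truncations converge to u in the t-adic topology: every
   coefficient is eventually constant, with the value of that of u. *)
Definition is_Tfrac (u : fps) (delta alpha : nat -> R) : Prop :=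
  forall n, exists N0, forall N, (N0 <= N)%N -> Tfrac_trunc delta alpha N 1 n = u n.

End PowerSeries.

(* Main.v *)
Require Import Defs.
From HB Require Import structures.
From mathcomp Require Import all_boot all_order all_algebra all_fingroup.
From mathcomp Require Import zify ring.
Set Implicit Arguments.
Unset Strict Implicit.
Unset Printing Implicit Defensive.
Import GRing.Theory.
Local Open Scope ring_scope.

(* Fix, for every position, whether it is a fixed point, a cycle valley or peak,
   or a cycle double rise or fall. The permutations with these types are built by
   drawing first all arcs going down, for the sources in increasing order, then
   all arcs going up, for the sources in decreasing order. When a source is
   processed, the crossings and nestings of its arc are the numbers of free
   targets on either side of the chosen one, so the choices contribute
   independent sums; moreover, since everything to the right is already drawn,
   exactly one choice closes a cycle if the source is a cycle valley, and none
   does if it is a cycle double rise. Hence the total weight of the permutations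
   of given types is a product over the steps of a lattice path whose height
   counts the arcs passing over a position. Steps at even and odd positions give
   two coupled recurrences for the path sums, which are solved by products of the
   tails of the continued fraction. *)

(** * Drawing increasing arcs one source at a time *)

Section Filling.

Variables (X : finType) (r : X -> nat).
Hypothesis r_inj : injective r.
Implicit Types (s : {perm X}) (S A T : {set X}) (x y l i : X).

(** The skeleton [s0] prescribes the arcs leaving points outside [S] and, through [s0 @: S], the
    targets left for [S]; how [s0] matches [S] with these targets is irrelevant. *)
Definition fill s0 S s : bool :=
  [forall x, if x \in S then (r x < r (s x))%N else s x == s0 x].

Definition crossing S s x : nat :=
  #|[set y in S | [&& (r y < r x), (r x < r (s y)) & (r (s y) < r (s x))]%N]|.

Definition nesting S s x : nat :=
  #|[set y in S | (r y < r x) && (r (s x) < r (s y))]%N|.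

(** Arcs increase [r], so the sources above [x] use up targets above [x]. The difference counts the
    targets still open to [x] when sources are treated from the highest down. *)
Definition covering T S x : nat :=
  (#|[set l in T | (r x < r l)%N]| - #|[set y in S | (r x < r y)%N]|)%N.

Lemma fillP s0 S s :
  reflect ((forall x, x \in S -> (r x < r (s x))%N) /\
           (forall x, x \notin S -> s x = s0 x)) (fill s0 S s).
Proof.
apply: (iffP forallP) => [H | [H1 H2] x].
  by split=> x xS; have := H x; rewrite ?(negbTE xS) ?xS // => /eqP.
by case: ifPn => [/H1 //|/H2 ->].
Qed.

Lemma imset_agree s0 S s : (forall x, x \notin S -> s x = s0 x) -> s @: S = s0 @: S.
Proof.
move=> H; apply/eqP; rewrite eqEcard !card_imset ?leqnn ?andbT //; try exact: perm_inj.
apply/subsetP => _ /imsetP[x xS ->]; rewrite -(permKV s0 (s x)) imset_f //.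
apply: contraLR xS => /[dup] zS /H; rewrite permKV => /perm_inj <-.
exact: zS.
Qed.

(** The transposition exchanges the images of [i] and of the source that [s0] sends to [l]. Both lie
    in [S], so nothing changes off [S], and [i] becomes frozen at [l]. *)
Lemma fill_step s0 S s i l : i \in S -> l \in s0 @: S -> (r i < r l)%N ->
  fill s0 S s && (s i == l) = fill (s0 * tperm (s0 i) l)%g (S :\ i) s.
Proof.
move=> iS lT il.
have off x : x \notin S -> (s0 * tperm (s0 i) l)%g x = s0 x.
  move=> xS; rewrite permM tpermD //.
    by apply: contra xS => /eqP/perm_inj <-.
  by apply: contra xS => /eqP E; move: lT; rewrite E (mem_imset _ _ (@perm_inj _ s0)).
have at_i : (s0 * tperm (s0 i) l)%g i = l by rewrite permM tpermL.
apply/andP/fillP => [[/fillP[H1 H2] /eqP E] | [H1 H2]].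
  split=> x; rewrite !inE; first by case/andP=> _ /H1.
  rewrite negb_and negbK => /orP[/eqP->|xS]; first by rewrite at_i.
  by rewrite off // H2.
have sil : s i = l by rewrite H2 ?at_i // !inE eqxx.
split; last by rewrite sil.
apply/fillP; split=> x xS.
  by have [->|ne] := eqVneq x i; [rewrite sil | apply: H1; rewrite !inE ne].
by rewrite H2 ?off // !inE (negbTE xS) andbF.
Qed.

Lemma fill_rec (R : comNzRingType) s0 S i (F : {perm X} -> R) : i \in S ->
  \sum_(s | fill s0 S s) F s =
  \sum_(l in [set l in s0 @: S | (r i < r l)%N])
    \sum_(s | fill (s0 * tperm (s0 i) l)%g (S :\ i) s) F s.
Proof.
move=> iS; rewrite (partition_big (fun s => s i)
  (fun l => l \in [set l in s0 @: S | (r i < r l)%N])) /= => [|s /fillP[H1 H2]].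
  apply: eq_bigr => l; rewrite inE => /andP[lT il].
  by apply: eq_bigl => s; exact: fill_step.
by rewrite inE H1 // -(imset_agree H2) imset_f.
Qed.

Lemma imset_step s0 S i l : i \in S -> l \in s0 @: S ->
  (s0 * tperm (s0 i) l)%g @: (S :\ i) = (s0 @: S) :\ l.
Proof.
move=> iS lT; set s1 := (s0 * _)%g.
have s1i : s1 i = l by rewrite permM tpermL.
have <- : s1 @: S = s0 @: S.
  apply/eqP; rewrite eqEcard !card_imset ?leqnn ?andbT; try exact: perm_inj.
  apply/subsetP => _ /imsetP[x xS ->]; rewrite permM.
  by case: tpermP => [_|_|_ _] //; rewrite imset_f.
have s1_inj := @perm_inj _ s1.
apply/setP => y; rewrite -[y](permKV s1) !inE !mem_imset // !inE -s1i.
by rewrite (inj_eq s1_inj).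
Qed.

Section Top.

Variables (s0 : {perm X}) (S : {set X}) (i : X).
Hypotheses (iS : i \in S) (i_max : forall y, y \in S -> (r y <= r i)%N).

Lemma lt_top y : y \in S -> y != i -> (r y < r i)%N.
Proof.
by move=> yS ne; rewrite ltn_neqAle i_max // andbT; apply: contra ne => /eqP/r_inj->.
Qed.

(** All other sources lie below [i], so an arc crossing that of [i] is determined by its target,
    which may be any target between [i] and [s i]. Thus only the choice of [s i] matters. *)
Lemma crossing_top s : fill s0 S s ->
  crossing S s i =
  #|[set l in [set l in s0 @: S | (r i < r l)%N] | (r l < r (s i))%N]|.
Proof.
move=> /fillP[H1 H2]; rewrite -(imset_agree H2) /crossing.
rewrite -(card_imset _ (@perm_inj _ s)); apply: eq_card => l.
apply/imsetP/idP => [[y /[!inE] /and4P[yS _ h1 h2] ->]|].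
  by rewrite imset_f // h1.
rewrite !inE -andbA => /and3P[/imsetP[y yS ->] h1 h2]; exists y => //.
rewrite !inE yS h1 h2 !andbT lt_top //.
by apply: contraTneq h2 => ->; rewrite ltnn.
Qed.

Lemma nesting_top s : fill s0 S s ->
  nesting S s i =
  #|[set l in [set l in s0 @: S | (r i < r l)%N] | (r (s i) < r l)%N]|.
Proof.
move=> /fillP[H1 H2]; rewrite -(imset_agree H2) /nesting.
rewrite -(card_imset _ (@perm_inj _ s)); apply: eq_card => l.
apply/imsetP/idP => [[y /[!inE] /and3P[yS _ h2] ->]|].
  by rewrite imset_f //= h2 andbT (ltn_trans _ h2) ?H1.
rewrite !inE -andbA => /and3P[/imsetP[y yS ->] h1 h2]; exists y => //.
rewrite !inE yS h2 !andbT lt_top //.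
by apply: contraTneq h2 => ->; rewrite ltnn.
Qed.

Lemma crossing_below s x : x \in S :\ i -> crossing (S :\ i) s x = crossing S s x.
Proof.
rewrite !inE => /andP[xi xS]; apply: eq_card => y; rewrite !inE.
have [->|_] //= := eqVneq y i.
by rewrite [(r i < r x)%N]ltnNge i_max // andbF.
Qed.

Lemma nesting_below s x : x \in S :\ i -> nesting (S :\ i) s x = nesting S s x.
Proof.
rewrite !inE => /andP[xi xS]; apply: eq_card => y; rewrite !inE.
have [->|_] //= := eqVneq y i.
by rewrite [(r i < r x)%N]ltnNge i_max // andbF.
Qed.

(** The removed source and the removed target both lie above [x], so the two cardinals drop
    together. *)
Lemma covering_below T l x : l \in T -> (r i < r l)%N -> x \in S :\ i ->
  covering (T :\ l) (S :\ i) x = covering T S x.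
Proof.
rewrite !inE => lT il /andP[xi xS]; rewrite /covering.
have xl : (r x < r l)%N by apply: ltn_trans il; exact: lt_top.
rewrite [in RHS](cardsD1 l) [X in (_ = _ - X)%N](cardsD1 i) !inE lT xl iS lt_top //=.
rewrite subnDl; congr (_ - _)%N; apply: eq_card => y; rewrite !inE;
  by rewrite -andbA.
Qed.

Lemma covering_top T : covering T S i = #|[set l in T | (r i < r l)%N]|.
Proof.
rewrite /covering [X in (_ - X)%N]eq_card0 ?subn0 // => y; rewrite !inE.
by apply/negP => /andP[/i_max]; rewrite leqNgt => /negP.
Qed.

End Top.

(** The element with [xi] others above it has [#|A| - 1 - xi] below it. The induction removes the
    highest element, which gives the term [xi = 0] and shifts the second argument of [v] for the
    rest. *)
Lemma rank_sum (R : comNzRingType) A (v : nat -> nat -> R) :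
  \sum_(l in A) v #|[set l' in A | (r l' < r l)%N]| #|[set l' in A | (r l < r l')%N]|
  = \sum_(xi < #|A|) v (#|A| - 1 - xi)%N xi.
Proof.
elim: {A}_.+1 {-2}A (ltnSn #|A|) v => // n IH A ltAn v.
have [->|[x0 x0A]] := set_0Vmem A; first by rewrite cards0 big_ord0 big_set0.
case: (arg_maxnP (P := mem A) r x0A) => i /[!inE] iA max_i.
have i_max y : y \in A -> (r y <= r i)%N := max_i y.
have lt_i y : y \in A -> y != i -> (r y < r i)%N.
  by move=> yS ne; rewrite ltn_neqAle i_max // andbT; apply: contra ne => /eqP/r_inj->.
have cA : #|A| = #|A :\ i|.+1 by rewrite (cardsD1 i) iA.
rewrite (big_setD1 i) //= cA big_ord_recl subn1 subn0 /=; congr (v _ _ + _).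
- apply: eq_card => y; rewrite !inE.
  by have [->|ne] /= := eqVneq y i; [rewrite ltnn andbF | apply/andb_idr => yA; exact: lt_i].
- by apply: eq_card0 => y; rewrite !inE; apply/negP => /andP[/i_max]; rewrite leqNgt => /negP.
have := IH (A :\ i) _ (fun p q => v p q.+1); rewrite -ltnS -cA => /(_ ltAn).
move=> IHi; transitivity (\sum_(l in A :\ i) v #|[set l' in A :\ i | (r l' < r l)%N]|
    #|[set l' in A :\ i | (r l < r l')%N]|.+1).
  apply: eq_bigr => l; rewrite !inE => /andP[li lA]; congr (v _ _).
    apply: eq_card => y; rewrite !inE; have [->|//] := eqVneq y i.
    by rewrite [(r i < _)%N]ltnNge i_max ?andbF.
  rewrite (cardsD1 i) !inE iA lt_i //=; congr _.+1.
  by apply: eq_card => y; rewrite !inE andbA.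
rewrite IHi; apply: eq_bigr => xi _ /=; congr (v _ _).
by rewrite /bump /= add1n -subnDA add1n.
Qed.

Lemma top_sum (R : comNzRingType) s0 S i (v : nat -> nat -> R) :
  i \in S -> (forall y, y \in S -> (r y <= r i)%N) ->
  let T := [set l in s0 @: S | (r i < r l)%N] in
  \sum_(l in T) v #|[set l' in T | (r l' < r l)%N]| #|[set l' in T | (r l < r l')%N]|
  = \sum_(xi < covering (s0 @: S) S i) v (covering (s0 @: S) S i - 1 - xi)%N xi.
Proof. by move=> iS i_max T; rewrite rank_sum covering_top. Qed.

(** The statistics of the highest source depend only on its target, and by [covering_below] the sum
    over the remaining sources is the same for every target, so it factors out. *)
Lemma fill_sum (R : comNzRingType) s0 S (w : X -> nat -> nat -> R) :
  \sum_(s | fill s0 S s) \prod_(x in S) w x (crossing S s x) (nesting S s x)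
  = \prod_(x in S) \sum_(xi < covering (s0 @: S) S x)
      w x (covering (s0 @: S) S x - 1 - xi)%N xi.
Proof.
elim: {S}_.+1 {-2}S (ltnSn #|S|) s0 => // n IH S ltSn s0.
have [->|[x0 x0S]] := set_0Vmem S.
  rewrite big_set0 (big_pred1 s0) ?big_set0 // => s.
  apply/fillP/eqP => [[_ H]|->]; last by split=> x //; rewrite inE.
  by apply/permP => x; rewrite H ?inE.
case: (arg_maxnP (P := mem S) r x0S) => i /[!inE] iS max_i.
have i_max y : y \in S -> (r y <= r i)%N := max_i y.
rewrite (fill_rec _ _ iS) [RHS](big_setD1 i) //= -top_sum // mulr_suml.
apply: eq_bigr => l; rewrite inE => /andP[lT il].
have ltS : (#|S :\ i| < n)%N by move: ltSn; rewrite (cardsD1 i) iS.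
set s1 := (s0 * _)%g.
transitivity (\sum_(s | fill s1 (S :\ i) s)
    (w i (crossing S s i) (nesting S s i) *
     \prod_(x in S :\ i) w x (crossing (S :\ i) s x) (nesting (S :\ i) s x))).
  apply: eq_bigr => s _; rewrite (big_setD1 i) //=; congr (_ * _).
  by apply: eq_bigr => x xS; rewrite crossing_below ?nesting_below.
transitivity (\sum_(s | fill s1 (S :\ i) s)
    (w i #|[set l' in [set l in s0 @: S | (r i < r l)%N] | (r l' < r l)%N]|
         #|[set l' in [set l in s0 @: S | (r i < r l)%N] | (r l < r l')%N]| *
     \prod_(x in S :\ i) w x (crossing (S :\ i) s x) (nesting (S :\ i) s x))).
  apply: eq_bigr => s; rewrite -fill_step // => /andP[fs /eqP sil].
  by rewrite (crossing_top i_max fs) (nesting_top iS i_max fs) sil.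
rewrite -mulr_sumr IH // imset_step //; congr (_ * _); apply: eq_bigr => x xS.
by rewrite covering_below.
Qed.

End Filling.

(** * Cycles closed by the arcs drawn so far *)

Section Cycles.

Variables (X : finType).
Implicit Types (s : {perm X}) (S A T : {set X}) (x y l i : X).

(** With [S] the sources still to be treated, these are the cycles that no later choice can
    alter. *)
Definition cyc_avoid s S : nat := #|[set C in porbits s | [disjoint C & S]]|.

(** The arcs already drawn lead from [l] to [i], possibly in zero steps, so that an arc from [i] to
    [l] would close a cycle. *)
Definition reaches s S l i : Prop :=
  exists p, (s ^+ p)%g l = i /\ forall q, (q < p)%N -> (s ^+ q)%g l \notin S.

(** Of two paths ending at [i], the shorter is a final segment of the longer. If it were a proper
    one, the predecessor of its start on the longer path would lie in [S]. *)
Lemma reaches_inj s S l l' i : l \in s @: S -> l' \in s @: S ->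
  reaches s S l i -> reaches s S l' i -> l = l'.
Proof.
move=> lT lT' [p [pl pS]] [p' [pl' pS']].
wlog le_pp' : l l' p p' lT lT' pl pS pl' pS' / (p <= p')%N.
  move=> W; have [/W|/ltnW/W] := leqP p p'; first exact.
  by move=> E; apply/esym/E.
have E : l = (s ^+ (p' - p))%g l'.
  by apply: (@perm_inj _ (s ^+ p)%g); rewrite -permM -expgD subnK // pl.
case: (p' - p)%N (leq_subr p p') E => [_ ->|k lek E]; first by rewrite expg0 perm1.
case/imsetP: lT => y yS; rewrite E expgSr permM => /perm_inj E'.
by have := pS' k lek; rewrite E' yS.
Qed.

(** Walk backwards from [i] to the first element of [S], which exists since the walk returns to [i];
    the image of that element is [l]. *)
Lemma reaches_exists s S i : i \in S -> exists2 l, l \in s @: S & reaches s S l i.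
Proof.
move=> iS; have exP : exists p, ((s^-1)%g ^+ p.+1)%g i \in S.
  exists (#[(s^-1)%g]%g.-1); rewrite prednK ?order_gt0 // expg_order perm1 //.
case: (ex_minnP exP) => p pS p_min.
exists (((s^-1)%g ^+ p)%g i).
  have -> : ((s^-1)%g ^+ p)%g i = s (((s^-1)%g ^+ p.+1)%g i) by rewrite expgSr permM permKV.
  exact: imset_f.
exists p; split=> [|q ltqp].
  by rewrite -permM expgVn mulVg perm1.
have -> : (s ^+ q)%g (((s^-1)%g ^+ p)%g i) = ((s^-1)%g ^+ (p - q))%g i.
  rewrite -{1}(subnK (ltnW ltqp)) expgD permM -permM [(_ ^+ q)%g]expgVn mulVg.
  by rewrite perm1.
apply/negP; case: (p - q)%N (leq_subr q p) (subn_gt0 q p) => [|k]; first by rewrite ltqp.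
by move=> ltk _ /p_min; rewrite leqNgt ltk.
Qed.

Lemma agree_iter s s' S l p : (forall x, x \notin S -> s' x = s x) ->
  (forall q, (q < p)%N -> (s ^+ q)%g l \notin S) ->
  forall q, (q <= p)%N -> (s' ^+ q)%g l = (s ^+ q)%g l.
Proof.
move=> agree pS; elim=> [|q IH] ltqp; first by rewrite !expg0.
by rewrite !expgSr !permM IH ?(ltnW ltqp) // agree // pS.
Qed.

Lemma porbit_agree s s' S x : (forall x, x \notin S -> s' x = s x) ->
  [disjoint porbit s x & S] -> porbit s' x = porbit s x.
Proof.
move=> agree dis.
have E q : (s' ^+ q)%g x = (s ^+ q)%g x.
  apply: (agree_iter (p := q) agree) => // k _.
  by rewrite (disjointFr dis) // mem_porbit.
by apply/setP => y; apply/porbitP/porbitP => -[k ->]; exists k; rewrite E.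
Qed.

(** The two permutations agree along drawn arcs. The cycle of [i] is therefore complete exactly when
    the path from [l] comes back to [i] before any other source in [S]. *)
Lemma closesP s S i l : i \in S ->
  let s1 := (s * tperm (s i) l)%g in l \in s @: S ->
  reflect (reaches s S l i) [disjoint porbit s1 i & S :\ i].
Proof.
move=> iS s1 lT; have s1i : s1 i = l by rewrite permM tpermL.
have lO : porbit s1 l = porbit s1 i by have := porbit_perm s1 1 i; rewrite expg1 s1i.
have off x : x \notin S -> s1 x = s x.
  move=> xS; rewrite permM tpermD //.
    by apply: contra xS => /eqP/perm_inj <-.
  by apply: contra xS => /eqP E; move: lT; rewrite E (mem_imset _ _ (@perm_inj _ s)).
have off' x : x \notin S -> s x = s1 x by move/off.
clearbody s1.
apply: (iffP idP) => [dis|[p [pl pS]]].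
  have exP : exists n, (s1 ^+ n)%g l == i.
    have /porbitP[n ->] : i \in porbit s1 l.
      by rewrite lO porbit_id.
    by exists n.
  case: (ex_minnP exP) => p /eqP pl p_min.
  have pS q : (q < p)%N -> (s1 ^+ q)%g l \notin S.
    move=> ltqp; have : (s1 ^+ q)%g l \in porbit s1 i.
      by rewrite -lO mem_porbit.
    move/(disjointFr dis); rewrite !inE => /negbT; rewrite negb_and negbK.
    by case/orP=> // /p_min; rewrite leqNgt ltqp.
  exists p; split=> [|q ltqp]; first by rewrite (agree_iter off' pS).
  by rewrite (agree_iter off' pS) ?pS // ltnW.
have E := agree_iter off pS.
(* The orbit of [l] under [s1] runs through the path from [l] to [i] again and again. *)
have inO n : (s1 ^+ n)%g l \notin S :\ i.
  suff [q [leqp ->]] : exists q, (q <= p)%N /\ (s1 ^+ n)%g l = (s ^+ q)%g l.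
    rewrite !inE negb_and negbK; move: leqp; rewrite leq_eqVlt => /orP[/eqP->|/pS->].
      by rewrite pl eqxx.
    by rewrite orbT.
  elim: n => [|n [q [leqp IH]]]; first by exists 0%N; rewrite !expg0.
  rewrite expgSr permM IH; move: leqp; rewrite leq_eqVlt => /orP[/eqP->|ltqp].
    by exists 0%N; rewrite pl s1i expg0 perm1.
  by exists q.+1; rewrite expgSr permM off ?pS.
apply/pred0P => y /=; apply/negP => /andP[yi]; apply/negP.
have /porbitP[n ->] : y \in porbit s1 l.
  by rewrite lO.
exact: inO.
Qed.

Lemma cyc_avoid_agree s s' S : (forall x, x \notin S -> s' x = s x) ->
  cyc_avoid s' S = cyc_avoid s S.
Proof.
move=> agree; have agree' x : x \notin S -> s x = s' x by move/agree.
apply: eq_card => C; rewrite !inE; apply/andP/andP => -[/imsetP[x _ ->] dis].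
  by rewrite -(porbit_agree agree' dis) imset_f // (porbit_agree agree' dis).
by rewrite -(porbit_agree agree dis) imset_f // (porbit_agree agree dis).
Qed.

(** The only cycle that can avoid [S :\ i] while meeting [S] is the cycle of [i]. *)
Lemma cyc_avoidD1 s S i : i \in S ->
  cyc_avoid s (S :\ i) = ([disjoint porbit s i & S :\ i] + cyc_avoid s S)%N.
Proof.
move=> iS; rewrite /cyc_avoid (cardsD1 (porbit s i)) inE imset_f //=; congr (_ + _)%N.
apply: eq_card => C; rewrite !inE andbCA; apply: andb_id2l => /imsetP[x _ ->].
have [E|ne] /= := eqVneq (porbit s x) (porbit s i).
  apply/esym/negbTE/negP => /disjointFl/(_ iS); rewrite E porbit_id //.
rewrite -{2}(setD1K iS) ![[disjoint porbit s x & _]]disjoint_sym !disjoints_subset.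
by rewrite subUset sub1set inE -eq_porbit_mem eq_sym ne.
Qed.

Lemma cyc_avoid0 s : cyc_avoid s set0 = #|porbits s|.
Proof.
by apply: eq_card => C; rewrite inE disjoint_sym disjoints_subset sub0set andbT.
Qed.

Lemma cyc_avoid_step s S i l : i \in S -> l \in s @: S ->
  let s1 := (s * tperm (s i) l)%g in
  cyc_avoid s1 (S :\ i) = ([disjoint porbit s1 i & S :\ i] + cyc_avoid s S)%N.
Proof.
move=> iS lT s1; rewrite cyc_avoidD1 //; congr (_ + _)%N.
apply: cyc_avoid_agree => x xS; rewrite permM tpermD //.
  by apply: contra xS => /eqP/perm_inj <-.
by apply: contra xS => /eqP E; move: lT; rewrite E (mem_imset _ _ (@perm_inj _ s)).
Qed.

End Cycles.

(** * Joint sums over cycles, crossings and nestings *)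

Section CycleWeights.

Variables (X : finType) (r : X -> nat).
Hypothesis r_inj : injective r.
Implicit Types (s : {perm X}) (S A T : {set X}) (x y l i : X).

(** The sum of crossings and nestings is thus the same for all targets, which lets the weight [a]
    factor out of the count of closed cycles. *)
Lemma rank_total A l : l \in A ->
  (#|[set l' in A | (r l' < r l)%N]| + #|[set l' in A | (r l < r l')%N]|)%N = (#|A| - 1)%N.
Proof.
move=> lA; rewrite (cardsD1 l A) lA add1n subn1 /=.
rewrite -(cardsID [set l' | (r l' < r l)%N] (A :\ l)); congr (_ + _)%N;
  apply: eq_card => y; rewrite !inE.
  by have [->|] /= := eqVneq y l; rewrite ?ltnn ?andbF.
have [->|ne] /= := eqVneq y l; first by rewrite ltnn !andbF.
rewrite andbC; congr (_ && _); rewrite -leqNgt ltn_neqAle.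
by rewrite (inj_eq r_inj) eq_sym ne.
Qed.

(** From a start below [i], the path would use only arcs that do not go up, so it could never rise
    to [i]; and [l] differs from [i] because [i] is not a target. *)
Lemma reaches_above s S i l : i \in S -> i \notin s @: S ->
  (forall x, x \notin S -> (r x < r i)%N -> (r (s x) <= r x)%N) ->
  l \in s @: S -> reaches s S l i -> (r i < r l)%N.
Proof.
move=> iS iT down lT [p [pl pS]]; rewrite ltnNge leq_eqVlt; apply/negP => /orP[/eqP/r_inj E|lt_li].
  by rewrite -E lT in iT.
suff H q : (q <= p)%N -> (r ((s ^+ q)%g l) <= r l)%N.
  by have := H p (leqnn p); rewrite pl leqNgt lt_li.
elim: q => [_|q IH ltqp]; first by rewrite expg0 perm1.
have leq := IH (ltnW ltqp); rewrite expgSr permM (leq_trans _ leq) // down ?pS //.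
exact: leq_ltn_trans lt_li.
Qed.

(* Arcs are chosen for the sources in decreasing order. If [i] is not a target,
   exactly one of the admissible images of [i] closes a cycle. *)
Lemma fill_cyc_sum (R : comNzRingType) (lam : R) (a : nat -> R) (d : nat -> nat -> R)
    s0 S :
  (forall x y, x \notin S -> y \in S -> (r x < r y)%N -> (r (s0 x) <= r x)%N) ->
  \sum_(s | fill r s0 S s) lam ^+ #|porbits s| *
     \prod_(x in S) (if x \in s0 @: S then d (crossing r S s x) (nesting r S s x)
                     else a (crossing r S s x + nesting r S s x)%N)
  = lam ^+ cyc_avoid s0 S *
    \prod_(x in S) (let k := covering r (s0 @: S) S x in
       if x \in s0 @: S then \sum_(xi < k) d (k - 1 - xi)%N xi
       else (lam + (k - 1)%:R) * a (k - 1)%N).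
Proof.
elim: {S}_.+1 {-2}S (ltnSn #|S|) s0 => // n IH S ltSn s0 down.
have [->|[x0 x0S]] := set_0Vmem S.
  rewrite cyc_avoid0 big_set0 (big_pred1 s0) ?big_set0 // => s.
  apply/fillP/eqP => [[_ H]|->]; last by split=> x //; rewrite inE.
  by apply/permP => x; rewrite H ?inE.
case: (arg_maxnP (P := mem S) r x0S) => i /[!inE] iS max_i.
have i_max y : y \in S -> (r y <= r i)%N := max_i y.
have ltS : (#|S :\ i| < n)%N by move: ltSn; rewrite (cardsD1 i) iS.
rewrite (fill_rec r _ _ iS) [\prod_(x in S) _](big_setD1 i) //=.
set T := s0 @: S; set k := covering r T S i; set P := \prod_(x in S :\ i) _.
set Tt := [set l in T | (r i < r l)%N].
pose b l := [disjoint porbit (s0 * tperm (s0 i) l)%g i & S :\ i].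
pose p l := #|[set l' in Tt | (r l' < r l)%N]|.
pose q l := #|[set l' in Tt | (r l < r l')%N]|.
have kE : k = #|Tt| by rewrite /k covering_top.
(* By induction, the choice of [l] matters only through its own weight and whether it closes a
   cycle. *)
transitivity (\sum_(l in Tt)
   lam ^+ b l * (if i \in T then d (p l) (q l) else a (p l + q l)%N) *
   (lam ^+ cyc_avoid s0 S * P)).
  apply: eq_bigr => l; rewrite inE => /andP[lT il].
  set s1 := (s0 * _)%g.
  transitivity (\sum_(s | fill r s1 (S :\ i) s)
    (if i \in T then d (p l) (q l) else a (p l + q l)%N) *
    (lam ^+ #|porbits s| * \prod_(x in S :\ i)
       (if x \in s1 @: (S :\ i)
        then d (crossing r (S :\ i) s x) (nesting r (S :\ i) s x)
        else a (crossing r (S :\ i) s x + nesting r (S :\ i) s x)%N))).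
    apply: eq_bigr => s; rewrite -fill_step // => /andP[fs /eqP sil].
    rewrite (big_setD1 i) //= mulrCA (crossing_top r_inj i_max fs).
    rewrite (nesting_top r_inj iS i_max fs) sil; congr (_ * (_ * _)).
    apply: eq_bigr => x xS; rewrite crossing_below ?nesting_below // imset_step // in_setD1.
    have -> // : x != l.
    move: xS; rewrite in_setD1 => /andP[_ /i_max]; apply: contraTneq => ->.
    by rewrite -ltnNge.
  rewrite -mulr_sumr IH //; last first.
    move=> x y; rewrite !inE => xS /andP[yi yS] xy.
    have xi : x != i by apply: contraTneq xy => ->; rewrite -leqNgt i_max.
    move: xS; rewrite xi /= => xS; rewrite permM tpermD; first exact: down xy.
      by apply: contra xS => /eqP/perm_inj <-.
    by apply: contra xS => /eqP E; move: lT; rewrite E (mem_imset _ _ (@perm_inj _ s0)).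
  rewrite cyc_avoid_step // -/s1 exprD imset_step // -/T !mulrA.
  congr (_ * _); first by rewrite -/(b l) [lam ^+ b l * _]mulrC.
  apply: eq_bigr => x xS; rewrite (covering_below r_inj iS i_max lT il xS) in_setD1.
  have -> // : x != l.
  move: xS; rewrite in_setD1 => /andP[_ /i_max]; apply: contraTneq => ->.
  by rewrite -ltnNge.
rewrite -mulr_suml mulrCA; congr (_ * (_ * P)).
case: ifPn => iT.
  have /= <- := @top_sum X r r_inj R s0 S i d iS i_max.
 apply: eq_bigr => l; rewrite inE => /andP[lT il].
  rewrite -[RHS]mul1r /b; congr (_ * _).
  (* Here [i] is itself a target and reaches [i] by the empty path, so by uniqueness no target above
     [i] closes a cycle. *)
  case: (closesP iS lT) => // ri; move: il; rewrite (reaches_inj lT iT ri) ?ltnn //.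
  by exists 0%N; rewrite expg0 perm1.
transitivity (\sum_(l in Tt) lam ^+ b l * a (k - 1)%N).
  by apply: eq_bigr => l lT; rewrite kE -(rank_total lT).
rewrite -mulr_suml; congr (_ * _).
(* The unique closing target [y] contributes [lam], each of the other [k - 1] contributes 1. *)
have [y yT ry] := reaches_exists s0 iS.
have iy : (r i < r y)%N by apply: reaches_above yT ry => // x xS /(down _ _ xS iS).
have yTt : y \in Tt by rewrite inE yT.
rewrite (big_setD1 y) //= /b; have -> : [disjoint porbit (s0 * tperm (s0 i) y)%g i & S :\ i].
  exact/(closesP iS yT).
rewrite expr1; congr (_ + _).
rewrite kE (cardsD1 y) yTt add1n subn1 /= -sum1_card natr_sum.
apply: eq_bigr => l; rewrite !inE => /and3P[ly lT il].
case: (closesP iS lT) => // rl; move: ly.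
by rewrite (reaches_inj lT yT rl ry) eqxx.
Qed.

End CycleWeights.

(** * Gluing permutations and building skeletons *)

Section PermutationTools.

Variables (X : finType).
Implicit Types (s : {perm X}) (S A B : {set X}) (x y : X).

(** On [s0 @: A], which it stabilizes, [s0^-1 * s] corrects the values of [s0] into those of [s];
    its restriction leaves the other values alone. *)
Lemma perm_glue s0 s A : s @: A = s0 @: A ->
  exists s1 : {perm X}, (forall x, x \in A -> s1 x = s x) /\
                        (forall x, x \notin A -> s1 x = s0 x).
Proof.
move=> E; exists (s0 * restr_perm (s0 @: A) (s0^-1 * s))%g.
have inj0 := @perm_inj _ s0; have inj1 := @perm_inj _ s.
have stab : (s0^-1 * s)%g \in 'N(s0 @: A | 'P)%g.
  apply/astabsP => y; rewrite /= apermE permM -{2}(permKV s0 y) -{1}E.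
  by rewrite !mem_imset.
split=> x xA; rewrite permM.
  by rewrite restr_permE ?imset_f // permM permK.
by rewrite (out_perm (restr_perm_on _ _)) // mem_imset.
Qed.

(** Exchanging a point of [A :\: B] with one of [B :\: A] brings [A] closer to [B] and moves nothing
    outside their union. *)
Lemma perm_imset_exists A B : #|A| = #|B| ->
  exists s, s @: A = B /\ forall x, x \notin A :|: B -> s x = x.
Proof.
elim: {A}_.+1 {-2}A (ltnSn #|A :\: B|) => // n IH A ltn eqAB.
have [E|[x]] := set_0Vmem (A :\: B).
  exists 1%g; split=> [|x _]; last by rewrite perm1.
  have -> : A = B by apply/eqP; rewrite eqEcard eqAB leqnn andbT -setD_eq0 E.
  by rewrite (eq_imset _ (@perm1 X)) imset_id.
rewrite inE => /andP[xB xA].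
have [E|[y]] := set_0Vmem (B :\: A).
  have E' : B = A by apply/eqP; rewrite eqEcard eqAB leqnn andbT -setD_eq0 E.
  by rewrite E' xA in xB.
rewrite inE => /andP[yA yB].
have injt := @perm_inj _ (tperm x y).
have memt z : (z \in tperm x y @: A) = (tperm x y z \in A).
  by rewrite -{1}[z](tpermK x y) mem_imset.
have [||s [sA sE]] := IH (tperm x y @: A).
- apply: leq_trans (_ : #|A :\: B| <= n)%N => //; apply: proper_card; apply/properP; split.
    apply/subsetP => z; rewrite !inE memt => /andP[zB]; rewrite zB /=.
    case: tpermP => [->||//]; first by rewrite xA.
    by move=> E; rewrite E yB in zB.
  by exists x; rewrite !inE ?xA ?xB // memt tpermL (negbTE yA).
- by rewrite card_imset.
exists (tperm x y * s)%g; split=> [|z].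
  by rewrite -sA -imset_comp; apply: eq_imset => z; rewrite /= permM.
rewrite inE negb_or => /andP[zA zB]; rewrite permM tpermD.
- by rewrite sE // inE memt negb_or zB andbT tpermD //;
  [apply: contraNneq zA => <- | apply: contraNneq zB => <-].
- by apply: contraNneq zA => <-.
- by apply: contraNneq zB => <-.
Qed.

(** On a cycle avoiding [S] the rank never increases, so its element of least rank is fixed. *)
Lemma cyc_avoid_fixed (r : X -> nat) s S : injective r ->
  (forall x, x \notin S -> (r (s x) <= r x)%N) ->
  cyc_avoid s S = #|[set x | (x \notin S) && (s x == x)]|.
Proof.
move=> r_inj down.
have fixE x : s x = x -> porbit s x = [set x].
  move=> sx; apply/setP => y; rewrite inE; apply/porbitP/eqP => [[n ->]|->].
    by elim: n => [|n IH]; rewrite ?expg0 ?perm1 // expgSr permM IH.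
  by exists 0%N; rewrite expg0 perm1.
rewrite -(@card_in_imset _ _ (porbit s)) => [|x y]; last first.
  by rewrite !inE => /andP[_ /eqP/fixE->] /andP[_ /eqP/fixE->]; exact: set1_inj.
apply: eq_card => C; rewrite !inE; apply/andP/imsetP => [[/imsetP[x0 _ ->] dis]|].
  case: (arg_minnP (P := mem (porbit s x0)) r (porbit_id s x0)) => x /[!inE] xC x_min.
  have xS : x \notin S by rewrite (disjointFr dis).
  exists x; last by apply/eqP; rewrite eq_sym eq_porbit_mem.
  rewrite !inE xS; apply/eqP/r_inj/eqP; rewrite eqn_leq down //.
  apply: x_min; rewrite inE -eq_porbit_mem -[s]expg1 porbit_perm eq_porbit_mem.
  by rewrite expg1.
case=> x /[!inE] /andP[xS /eqP sx] ->; split; first exact: imset_f.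
by rewrite fixE // disjoints1.
Qed.

(** The intermediate permutation can be recovered from [s]: it is [s0] on [S] and [s] elsewhere, a
    permutation because both have the same image of [S]. *)
Lemma two_stage (r r' : X -> nat) (R : comNzRingType) s0 S S' (F : {perm X} -> R) :
  [disjoint S & S'] ->
  \sum_(s1 | fill r' s0 S' s1) \sum_(s | fill r s1 S s) F s =
  \sum_(s : {perm X} | [forall x, if x \in S then (r x < r (s x))%N else
                       if x \in S' then (r' x < r' (s x))%N else s x == s0 x]
            && (s @: S == s0 @: S)) F s.
Proof.
move=> dis.
pose P (s : {perm X}) := [forall x, if x \in S then (r x < r (s x))%N else
  if x \in S' then (r' x < r' (s x))%N else s x == s0 x] && (s @: S == s0 @: S).
have fill2 s s1 : fill r' s0 S' s1 -> fill r s1 S s -> P s.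
  move=> /fillP[H1 H2] /fillP[H3 H4]; apply/andP; split.
    apply/forallP => x; case: ifPn => [/H3 //|xS]; rewrite H4 //.
    by case: ifPn => [/H1 //|/H2->].
  rewrite (imset_agree H4); apply/eqP; apply: eq_in_imset => x xS.
  by rewrite H2 // (disjointFr dis).
rewrite (exchange_big_dep P) /=; last by move=> s1 s; exact: fill2.
apply: eq_bigr => s /andP[/forallP H /eqP E].
have [s1 [on_S off_S]] := perm_glue (esym E).
rewrite (big_pred1 s1) // => s2; apply/andP/eqP => [[/fillP[H1 H2] /fillP[H3 H4]]|->].
  apply/permP => x; have [xS|xS] := boolP (x \in S).
    by rewrite on_S // H2 // (disjointFr dis).
  by rewrite off_S ?H4.
split; apply/fillP; split=> x xS.
- have xS' : x \notin S by rewrite (disjointFl dis).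
  by have := H x; rewrite (negbTE xS') xS off_S.
- have [/on_S //|xS'] := boolP (x \in S).
  by have := H x; rewrite (negbTE xS) (negbTE xS') off_S // => /eqP.
- by have := H x; rewrite xS.
- by rewrite off_S.
Qed.

End PermutationTools.

(** * Types of positions and heights *)

Definition is_val (b : bool) (x : option bool) : bool := ~~ b && (x == Some true).
Definition is_peak (b : bool) (x : option bool) : bool := b && (x == Some true).

(** Valleys raise the path and peaks lower it. [b] is the parity of the first position and [k] the
    initial height, so that a path without its first step is again of this form. *)
Definition height (m : nat) (b : bool) (k : nat) (tau : 'I_m -> option bool) (i : nat) : nat :=
  (k + \sum_(j < m | (j < i)%N) is_val (b (+) odd j) (tau j)
     - \sum_(j < m | (j < i)%N) is_peak (b (+) odd j) (tau j))%N.

Section Types.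

Variable m : nat.
Implicit Types (s : {perm 'I_m}) (i j k l : 'I_m) (tau : 'I_m -> option bool).

(* [None] marks a fixed point, [Some true] a cycle valley or peak, [Some false]
   a cycle double rise or fall; the parity of the position tells which. *)
Definition arc_type s : {ffun 'I_m -> option bool} :=
  [ffun i : 'I_m => if s i == i then None
            else Some (if odd i then ((s^-1)%g i < i)%N else (i < (s^-1)%g i)%N)].

Definition up_src tau : {set 'I_m} := [set i : 'I_m | ~~ odd i && (tau i != None)].
Definition lo_src tau : {set 'I_m} := [set i : 'I_m | odd i && (tau i != None)].
(** Upward arcs end at peaks (odd ordinals, [Some true]) and at double rises (even ordinals,
    [Some false]), whence the comparison with the parity. *)
Definition up_tgt tau : {set 'I_m} := [set i : 'I_m | tau i == Some (odd i)].
Definition lo_tgt tau : {set 'I_m} := [set i : 'I_m | tau i == Some (~~ odd i)].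

Definition has_type tau s : bool :=
  [forall i, if i \in up_src tau then (i < s i)%N else
             if i \in lo_src tau then (s i < i)%N else s i == i]
  && (s @: up_src tau == up_tgt tau).

Lemma has_typeP tau s : has_type tau s ->
  [/\ forall i, (i < s i)%N = (i \in up_src tau),
      forall i, (s i < i)%N = (i \in lo_src tau),
      forall i, (s i == i) = (tau i == None) &
      forall i, (s i \in up_tgt tau) = (i \in up_src tau)].
Proof.
case/andP=> /forallP H /eqP E.
have Hu i : (i < s i)%N = (i \in up_src tau).
  have := H i; case: ifP => [_ -> //|_]; case: ifP => [_ lt|_ /eqP->]; last by rewrite ltnn.
  by rewrite ltnNge ltnW.
have Hl i : (s i < i)%N = (i \in lo_src tau).
  have := H i; case: ifP => [|_]; last by case: ifP => // _ /eqP->; rewrite ltnn.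
  by rewrite !inE => /andP[/negbTE-> _] lt /=; rewrite ltnNge ltnW.
split=> // [i|i]; last by rewrite -E mem_imset //; exact: perm_inj.
have -> : (s i == i) = ~~ (i < s i)%N && ~~ (s i < i)%N.
  by rewrite -!leqNgt -eqn_leq.
by rewrite Hu Hl !inE; case: odd => /=; rewrite ?andbT negbK.
Qed.

Lemma has_type_inv tau s i : has_type tau s ->
  ((s^-1)%g i < i)%N = (i \in up_tgt tau) /\ (i < (s^-1)%g i)%N = (i \in lo_tgt tau).
Proof.
move=> /has_typeP[Hu Hl Hf Ht].
have E1 : ((s^-1)%g i < i)%N = (i \in up_tgt tau).
  by rewrite -{2 3}[i](permKV s) Ht -Hu permKV.
split=> //; rewrite ltn_neqAle leqNgt E1 -[_ == _ :> nat]/(i == (s^-1)%g i).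
by rewrite -(inj_eq (@perm_inj _ s)) permKV Hf !inE; case: (tau i) => [[]|] /=; case: odd.
Qed.

(** Parity fixes the direction of the arc leaving a moved position; whether an upward arc arrives
    there then decides between [Some true] and [Some false]. *)
Lemma Dperm_arc_type tau s : Dperm s && (arc_type s == finfun tau) = has_type tau s.
Proof.
apply/andP/idP => [[/forallP D /eqP E]|H].
  have Et i : tau i = arc_type s i by rewrite E ffunE.
  have Hf i : (tau i == None) = (s i == i) by rewrite Et ffunE; case: (s i == i).
  apply/andP; split.
    apply/forallP => i; rewrite !inE Hf; have := D i; rewrite /label /=.
    have [->|ne] := eqVneq (s i) i; rewrite ?andbF ?eqxx // !andbT.
    have ne' : i != s i by rewrite eq_sym.
    by case: odd => /= le; rewrite ltn_neqAle le andbT.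
  apply/eqP/setP => i; rewrite -[i](permKV s) mem_imset; last exact: perm_inj.
  move: ((s^-1)%g i) => j; rewrite !inE Hf Et ffunE permK (inj_eq (@perm_inj _ s)).
  have [_|ne] := eqVneq (s j) j; first by rewrite andbF.
  rewrite andbT; have lt : if odd j then (s j < j)%N else (j < s j)%N.
    have ne' : j != s j by rewrite eq_sym.
    by have := D j; rewrite /label /=; case: odd => /= le; rewrite ltn_neqAle le andbT.
  case: (odd j) lt => /= lt; rewrite lt [(_ < _)%N]ltnNge ltnW //=.
    by case: odd.
  by case: odd.
have [Hu Hl Hf Ht] := has_typeP H.
split.
  apply/forallP => i; rewrite /label /= leqNgt Hl [(s i <= i)%N]leqNgt Hu !inE.
  by case: odd.
apply/eqP/ffunP => i; rewrite !ffunE Hf.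
have [-> ->] := has_type_inv i H; rewrite !inE.
by case: (tau i) => [[]|] //=; case: odd.
Qed.

End Types.

Ltac lia_ord := unfold reverse_coercion in *; lia.

(** * Statistics of the permutations of a given type *)

Section Statistics.

Variable m : nat.
Implicit Types (s : {perm 'I_m}) (i j k l : 'I_m) (tau : 'I_m -> option bool).

(** In each of the four statistics, one entry of the triple determines the other two. *)
Lemma ucrossE s j :
  ucross j s = #|[set i : 'I_m | [&& i < j, j < s i & s i < s j]%N]|.
Proof.
have f_inj : injective (fun i : 'I_m => (i, s i, s j)) by move=> x y [].
rewrite -(card_imset _ f_inj); apply: eq_card => -[[i k] l]; rewrite inE.
apply/and3P/imsetP => [[q /eqP e1 /eqP e2]|[x + [-> -> ->]]].
  by rewrite e1 e2 in q *; exists i; rewrite // inE.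
by rewrite inE => q; split.
Qed.

Lemma unestE s j :
  unest j s = #|[set i : 'I_m | [&& i < j, j < s j & s j < s i]%N]|.
Proof.
have f_inj : injective (fun i : 'I_m => (i, s j, s i)) by move=> x y [].
rewrite -(card_imset _ f_inj); apply: eq_card => -[[i k] l]; rewrite inE.
apply/and3P/imsetP => [[q /eqP e1 /eqP e2]|[x + [-> -> ->]]].
  by rewrite e1 e2 in q *; exists i; rewrite // inE.
by rewrite inE => q; split.
Qed.

Lemma lcrossE s k :
  lcross k s = #|[set l : 'I_m | [&& s k < s l, s l < k & k < l]%N]|.
Proof.
have f_inj : injective (fun l : 'I_m => (s k, s l, l)) by move=> x y [].
rewrite -(card_imset _ f_inj); apply: eq_card => -[[i j] l]; rewrite inE.
apply/and3P/imsetP => [[q /eqP e1 /eqP e2]|[x + [-> -> ->]]].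
  by rewrite e1 e2 in q *; exists l; rewrite // inE.
by rewrite inE => q; split.
Qed.

Lemma lnestE s k :
  lnest k s = #|[set l : 'I_m | [&& s l < s k, s k < k & k < l]%N]|.
Proof.
have f_inj : injective (fun l : 'I_m => (s l, s k, l)) by move=> x y [].
rewrite -(card_imset _ f_inj); apply: eq_card => -[[i j] l]; rewrite inE.
apply/and3P/imsetP => [[q /eqP e1 /eqP e2]|[x + [-> -> ->]]].
  by rewrite e1 e2 in q *; exists l; rewrite // inE.
by rewrite inE => q; split.
Qed.

Lemma eq_ord_set (p q : pred 'I_m) : (forall i, p i = q i) -> [set i | p i] = [set i | q i].
Proof. by move=> E; apply/setP => i; rewrite !in_set E. Qed.

Lemma eq_card_ord (p q : pred 'I_m) :
  (forall i, p i = q i) -> #|[set i | p i]| = #|[set i | q i]|.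
Proof. by move=> /eq_ord_set->. Qed.

Section OfType.

Variables (tau : 'I_m -> option bool) (s : {perm 'I_m}).
Hypothesis s_type : has_type tau s.

Lemma crossing_up i : crossing (@nat_of_ord m) (up_src tau) s i = ucross i s.
Proof.
have [Hu _ _ _] := has_typeP s_type.
by rewrite ucrossE; apply: eq_card_ord => j /=; rewrite -Hu; lia_ord.
Qed.

Lemma nesting_up i : i \in up_src tau ->
  nesting (@nat_of_ord m) (up_src tau) s i = unest i s.
Proof.
have [Hu _ _ _] := has_typeP s_type; rewrite -Hu => lti.
by rewrite unestE; apply: eq_card_ord => j /=; rewrite -Hu; lia_ord.
Qed.

Lemma crossing_lo i : crossing (fun j : 'I_m => (m - j)%N) (lo_src tau) s i = lcross i s.
Proof.
have [_ Hl _ _] := has_typeP s_type.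
rewrite lcrossE; apply: eq_card_ord => j /=; rewrite -Hl.
by have := ltn_ord i; have := ltn_ord j; have := ltn_ord (s i); have := ltn_ord (s j); lia_ord.
Qed.

Lemma nesting_lo i : i \in lo_src tau ->
  nesting (fun j : 'I_m => (m - j)%N) (lo_src tau) s i = lnest i s.
Proof.
have [_ Hl _ _] := has_typeP s_type; rewrite -Hl => lti.
rewrite lnestE; apply: eq_card_ord => j /=; rewrite -Hl.
by have := ltn_ord i; have := ltn_ord j; have := ltn_ord (s i); have := ltn_ord (s j); lia_ord.
Qed.

End OfType.

Lemma card_sum (p : pred 'I_m) : #|[set j | p j]| = (\sum_j p j)%N.
Proof. by rewrite -sum1dep_card big_mkcond; apply: eq_bigr => j _; case: (p j). Qed.

Lemma sum_around (v : 'I_m -> nat) i :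
  (\sum_(j < m | (j < i)%N) v j + v i + \sum_(j < m | (i < j)%N) v j = \sum_j v j)%N.
Proof.
rewrite [RHS](bigID (fun j : 'I_m => (j < i)%N)) /= -addnA; congr (_ + _)%N.
rewrite [RHS](bigD1 i) ?ltnn //=; congr (_ + _)%N; apply: eq_bigl => j.
by rewrite -leqNgt ltn_neqAle andbC eq_sym.
Qed.

Section Counting.

Variable tau : 'I_m -> option bool.

Let vals (p : pred 'I_m) : nat := (\sum_(j | p j) is_val (odd j) (tau j))%N.
Let peaks (p : pred 'I_m) : nat := (\sum_(j | p j) is_peak (odd j) (tau j))%N.

(** Double rises are both sources and targets of upward arcs, as double falls are of downward ones.
    They cancel in differences, leaving valleys against peaks. *)
Lemma card_up_src p : #|[set j in up_src tau | p j]| =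
  (\sum_(j | p j) (~~ odd j && (tau j == Some false)) + vals p)%N.
Proof.
rewrite card_sum /vals -big_split [RHS]big_mkcond; apply: eq_bigr => j _ /=.
by rewrite inE /is_val; case: (p j); case: (tau j) => [[]|]; case: odd.
Qed.

Lemma card_up_tgt p : #|[set j in up_tgt tau | p j]| =
  (\sum_(j | p j) (~~ odd j && (tau j == Some false)) + peaks p)%N.
Proof.
rewrite card_sum /peaks -big_split [RHS]big_mkcond; apply: eq_bigr => j _ /=.
by rewrite inE /is_peak; case: (p j); case: (tau j) => [[]|]; case: odd.
Qed.

Lemma card_lo_src p : #|[set j in lo_src tau | p j]| =
  (\sum_(j | p j) (odd j && (tau j == Some false)) + peaks p)%N.
Proof.
rewrite card_sum /peaks -big_split [RHS]big_mkcond; apply: eq_bigr => j _ /=.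
by rewrite inE /is_peak; case: (p j); case: (tau j) => [[]|]; case: odd.
Qed.

Lemma card_lo_tgt p : #|[set j in lo_tgt tau | p j]| =
  (\sum_(j | p j) (odd j && (tau j == Some false)) + vals p)%N.
Proof.
rewrite card_sum /vals -big_split [RHS]big_mkcond; apply: eq_bigr => j _ /=.
by rewrite inE /is_val; case: (p j); case: (tau j) => [[]|]; case: odd.
Qed.

(** An upward arc starting before [i] ends before [i] or passes over it. Hence [psnest] is the
    number of upward sources before [i] minus that of upward targets. *)
Lemma psnest_height s i : has_type tau s -> tau i = None ->
  psnest i s = height false 0 tau i.
Proof.
move=> s_type ti; have [Hu _ Hf Ht] := has_typeP s_type.
have si : s i = i by apply/eqP; rewrite Hf ti.
have := card_up_src (fun j => (j < i)%N); have := card_up_tgt (fun j => (j < i)%N).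
have -> : #|[set j in up_tgt tau | (j < i)%N]| = #|[set j in up_src tau | (s j < i)%N]|.
  rewrite -[RHS](card_imset _ (@perm_inj _ s)); apply: eq_card => j.
  by rewrite -[j](permKV s) mem_imset; [rewrite [LHS]in_set [RHS]in_set Ht | exact: perm_inj].
rewrite -(cardsID [set j : 'I_m | (s j < i)%N] [set j in up_src tau | (j < i)%N]).
have -> : [set j in up_src tau | (j < i)%N] :&: [set j | (s j < i)%N]
        = [set j in up_src tau | (s j < i)%N].
  apply/setP => j; rewrite in_setI [X in X && _]in_set [X in _ && X]in_set [RHS]in_set -Hu.
  by lia_ord.
have -> : #|[set j in up_src tau | (j < i)%N] :\: [set j | (s j < i)%N]| = psnest i s.
  apply: eq_card => j; rewrite in_setD [X in _ && X]in_set [X in ~~ X]in_set [RHS]in_set -Hu.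
  have [->|ne] := eqVneq j i; first by rewrite ltnn !andbF.
  have : s j != i by rewrite -si (inj_eq (@perm_inj _ s)).
  by rewrite -val_eqE /=; lia_ord.
by rewrite /height /vals /peaks /=; lia_ord.
Qed.

Hypothesis balanced : vals predT = peaks predT.

(** Balance turns peaks minus valleys after [i] into valleys minus peaks up to [i]; the valley [i]
    itself is the 1 subtracted. *)
Lemma covering_val i : ~~ odd i -> tau i = Some true ->
  (covering (@nat_of_ord m) (up_tgt tau) (up_src tau) i - 1)%N = height false 0 tau i.
Proof.
move=> oi ti; rewrite /covering card_up_src card_up_tgt /height /= -/(vals _) -/(peaks _).
have := sum_around (fun j => is_val (odd j) (tau j)) i.
have := sum_around (fun j => is_peak (odd j) (tau j)) i.
rewrite -/(vals predT) -/(peaks predT) balanced /vals /peaks ti /is_val /is_peak oi (negbTE oi) /=.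
by lia_ord.
Qed.

Lemma covering_drise i : ~~ odd i -> tau i = Some false ->
  covering (@nat_of_ord m) (up_tgt tau) (up_src tau) i = height false 0 tau i.
Proof.
move=> oi ti; rewrite /covering card_up_src card_up_tgt /height /= -/(vals _) -/(peaks _).
have := sum_around (fun j => is_val (odd j) (tau j)) i.
have := sum_around (fun j => is_peak (odd j) (tau j)) i.
rewrite -/(vals predT) -/(peaks predT) balanced /vals /peaks ti /is_val /is_peak oi (negbTE oi) /=.
by lia_ord.
Qed.

Lemma covering_lo i :
  covering (fun j : 'I_m => (m - j)%N) (lo_tgt tau) (lo_src tau) i = height false 0 tau i.
Proof.
rewrite /covering.
have E (A : {set 'I_m}) : [set l in A | (m - i < m - l)%N] = [set l in A | (l < i)%N].
  by apply/setP => l; rewrite !inE; have := ltn_ord i; have := ltn_ord l; lia_ord.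
by rewrite !E card_lo_src card_lo_tgt /height /vals /peaks /=; lia_ord.
Qed.

(** Balance makes upward sources and upward targets equinumerous. A permutation matching them and
    fixing the positions of type [None] must match the downward ones as well. *)
Lemma type_skeleton : exists s, [/\ s @: up_src tau = up_tgt tau,
  s @: lo_src tau = lo_tgt tau & forall i, tau i = None -> s i = i].
Proof.
have [|s [sS sE]] := @perm_imset_exists _ (up_src tau) (up_tgt tau).
  have cT (A : {set 'I_m}) : #|[set j in A | predT j]| = #|A|.
    by apply: eq_card => j; rewrite inE andbT.
  by have := card_up_src predT; have := card_up_tgt predT; rewrite !cT balanced => -> ->.
have sf i : tau i = None -> s i = i by move=> ti; rewrite sE // !inE ti andbF.
exists s; split=> //; apply/setP => i; rewrite -[i](permKV s) mem_imset; last exact: perm_inj.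
set j := (s^-1)%g i.
have : (s j \in up_tgt tau) = (j \in up_src tau).
  by rewrite -sS mem_imset //; exact: perm_inj.
have nE : (tau (s j) == None) = (tau j == None).
  apply/eqP/eqP => [E|E]; last by rewrite (sf _ E).
  by have sj := perm_inj (sf _ E); rewrite sj in E.
by rewrite !inE; move: nE; case: (tau j) => [[]|]; case: (tau (s j)) => [[]|]; case: odd; case: odd.
Qed.

End Counting.

End Statistics.

(** * Total weight of a type *)

Section Weights.

Variables (R : comNzRingType) (lam : R) (a : nat -> R).
Variables (b c d : nat -> nat -> R) (e f : nat -> R).

(** The sum over the choices among [k] free targets. It is empty for [k = 0], so a peak at height 0
    has weight 0. *)
Definition diag_sum (w : nat -> nat -> R) (k : nat) : R :=
  \sum_(xi < k) w (k - 1 - xi)%N xi.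

(* [p] is the parity of the ordinal, opposite to that of its label. *)
Definition step_weight (p : bool) (x : option bool) (k : nat) : R :=
  match x, p with
  | Some true, false => (lam + k%:R) * a k
  | Some true, true => diag_sum b k
  | Some false, false => diag_sum d k
  | Some false, true => diag_sum c k
  | None, false => lam * f k
  | None, true => lam * e k
  end.

Section FixedType.

Variable m : nat.
Implicit Types (s : {perm 'I_m}) (i j k l : 'I_m) (tau : 'I_m -> option bool).

Let r (i : 'I_m) : nat := i.
(* Ranking by [r'] reverses the order, so that the arcs going down increase it. *)
Let r' (i : 'I_m) : nat := (m - i)%N.

Let r_inj : injective r.
Proof. exact: val_inj. Qed.

Let r'_inj : injective r'.
Proof.
move=> i j; rewrite /r' => E; apply: val_inj => /=.
by have := ltn_ord i; have := ltn_ord j; lia.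
Qed.

Definition perm_weight s : R :=
  lam ^+ cyc s
    * (\prod_(i in Cval s) a (ucross i s + unest i s)%N)
    * (\prod_(i in Cpeak s) b (lcross i s) (lnest i s))
    * (\prod_(i in Cdfall s) c (lcross i s) (lnest i s))
    * (\prod_(i in Cdrise s) d (ucross i s) (unest i s))
    * (\prod_(i in Evenfix s) e (psnest i s))
    * (\prod_(i in Oddfix s) f (psnest i s)).

Let lo_weight tau (i : 'I_m) (p q : nat) : R :=
  if i \in lo_tgt tau then c p q else b p q.

Lemma prod_shuffle (x u1 u2 l1 l2 g1 g2 : R) :
  x * u2 * l2 * l1 * u1 * g1 * g2 = x * (u1 * u2) * (l1 * l2 * (g1 * g2)).
Proof. by ring. Qed.

Lemma type_weight tau s : has_type tau s -> perm_weight s =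
  lam ^+ #|porbits s| *
  (\prod_(i in up_src tau) (if i \in up_tgt tau
      then d (crossing r (up_src tau) s i) (nesting r (up_src tau) s i)
      else a (crossing r (up_src tau) s i + nesting r (up_src tau) s i)%N)) *
  ((\prod_(i in lo_src tau)
      lo_weight tau i (crossing r' (lo_src tau) s i) (nesting r' (lo_src tau) s i)) *
   \prod_(i | tau i == None)
      (if odd i then e (height false 0 tau i) else f (height false 0 tau i))).
Proof.
move=> st; have [Hu Hl Hf Ht] := has_typeP st.
have split_prod (A : {set 'I_m}) (P : pred 'I_m) (F1 F2 : 'I_m -> R) :
    \prod_(i in A) (if P i then F1 i else F2 i) =
    \prod_(i in [set i in A | P i]) F1 i * \prod_(i in [set i in A | ~~ P i]) F2 i.
  rewrite (bigID P) /=; congr (_ * _).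
    by apply: eq_big => i; rewrite ?inE // => /andP[_ ->].
  by apply: eq_big => i; rewrite ?inE // => /andP[_ /negbTE->].
rewrite split_prod; set U1 := \prod_(i in [set i in up_src _ | _]) _; set U2 := \prod_(i in _) _.
rewrite split_prod; set L1 := \prod_(i in [set i in lo_src _ | _]) _; set L2 := \prod_(i in _) _.
have EU2 : \prod_(i in Cval s) a (ucross i s + unest i s)%N = U2.
  apply: eq_big => i.
    rewrite !in_set Hu; have [_ ->] := has_type_inv i st.
    by rewrite !inE; case: (tau i) => [[]|]; case: odd.
  rewrite inE Hu => /andP[_ iS].
  by rewrite (crossing_up st) (nesting_up st).
have EU1 : \prod_(i in Cdrise s) d (ucross i s) (unest i s) = U1.
  apply: eq_big => i.
    rewrite !in_set Hu; have [-> _] := has_type_inv i st.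
    by rewrite !inE; case: (tau i) => [[]|]; case: odd.
  rewrite inE Hu => /andP[_ iS].
  by rewrite (crossing_up st) (nesting_up st).
have EL2 : \prod_(i in Cpeak s) b (lcross i s) (lnest i s) = L2.
  apply: eq_big => i.
    rewrite !in_set Hl; have [-> _] := has_type_inv i st.
    by rewrite !inE; case: (tau i) => [[]|]; case: odd.
  rewrite inE Hl => /andP[_ iS].
  by rewrite (crossing_lo st) (nesting_lo st).
have EL1 : \prod_(i in Cdfall s) c (lcross i s) (lnest i s) = L1.
  apply: eq_big => i.
    rewrite !in_set Hl; have [_ ->] := has_type_inv i st.
    by rewrite !inE; case: (tau i) => [[]|]; case: odd.
  rewrite inE Hl => /andP[_ iS].
  by rewrite (crossing_lo st) (nesting_lo st).
set FX := \prod_(i | tau i == None) _.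
have EF : FX = \prod_(i in Evenfix s) e (psnest i s) * \prod_(i in Oddfix s) f (psnest i s).
  rewrite /FX (bigID (fun i : 'I_m => odd i)) /=; congr (_ * _).
    apply: eq_big => i; first by rewrite inE /label /= negbK Hf andbC.
    by case/andP=> /eqP ti ->; rewrite (psnest_height st).
  apply: eq_big => i; first by rewrite inE /label /= Hf andbC.
  by case/andP=> /eqP ti /negbTE->; rewrite (psnest_height st).
rewrite /perm_weight EU1 EU2 EL1 EL2 EF /cyc.
exact: prod_shuffle.
Qed.

(** Without balance no permutation maps the upward sources onto the upward targets. Otherwise
    [fill_sum] draws the downward arcs and [fill_cyc_sum] the upward ones. *)
Lemma type_sum tau :
  \sum_(s | has_type tau s) perm_weight s =
  if (\sum_(i < m) is_val (odd i) (tau i) == \sum_(i < m) is_peak (odd i) (tau i))%N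
  then \prod_(i < m) step_weight (odd i) (tau i) (height false 0 tau i) else 0.
Proof.
case: ifPn => [/eqP bal|unbal]; last first.
  apply: big_pred0 => s; apply/negP => /andP[_ /eqP E]; case/negP: unbal.
  have cT (A : {set 'I_m}) : #|[set j in A | predT j]| = #|A|.
    by apply: eq_card => j; rewrite inE andbT.
  have := card_up_src tau predT; have := card_up_tgt tau predT.
  by rewrite !cT -E card_imset; [move=> -> /addnI bal; apply/eqP/esym/bal | exact: perm_inj].
have [s0 [s0u s0l s0f]] := type_skeleton bal.
set S := up_src tau; set S' := lo_src tau.
have dis : [disjoint S & S'].
  by apply/pred0P => i /=; rewrite !inE; case: odd; rewrite ?andbF.
under eq_bigr => s st do rewrite (type_weight st).
set K := \prod_(i | _) _.
rewrite (eq_bigl (fun s : {perm 'I_m} => [forall x, if x \in S then (r x < r (s x))%N else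
  if x \in S' then (r' x < r' (s x))%N else s x == s0 x] && (s @: S == s0 @: S))); last first.
  move=> s; rewrite /has_type s0u; congr (_ && _).
  apply: eq_forallb => i; rewrite /r'; have := ltn_ord i; have := ltn_ord (s i).
  have [|iS] //= := boolP (i \in S); have [|iS'] := boolP (i \in S').
    by unfold reverse_coercion; lia.
  rewrite s0f //; move: iS iS'; rewrite !inE.
  by case: odd; case: (tau i).
rewrite -two_stage //.
pose G := \prod_(x in S) (let k := covering r (up_tgt tau) S x in
       if x \in up_tgt tau then \sum_(xi < k) d (k - 1 - xi)%N xi
       else (lam + (k - 1)%:R) * a (k - 1)%N).
pose L := lam ^+ #|[set i | tau i == None]|.
transitivity (\sum_(s1 | fill r' s0 S' s1) (L * G * K) *
   \prod_(i in S') lo_weight tau i (crossing r' S' s1 i) (nesting r' S' s1 i)).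
  apply: eq_bigr => s1 /fillP[on_S' off_S'].
  have s1u : s1 @: S = up_tgt tau.
    by rewrite -s0u; apply: eq_in_imset => i iS; rewrite off_S' // (disjointFr dis).
  have s1f i : i \notin S -> i \notin S' -> s1 i = i.
    move=> iS iS'; rewrite off_S' // s0f //.
    by move: iS iS'; rewrite !inE; case: odd; case: (tau i).
  have lo i : i \in S' -> (s1 i < i)%N.
    by move/on_S'; rewrite /r'; have := ltn_ord i; lia.
  have down i : i \notin S -> (r (s1 i) <= r i)%N.
    move=> iS; have [/lo/ltnW//|iS'] := boolP (i \in S').
    by rewrite s1f.
  (* The second stage does not touch the arcs leaving [S'], so their weights can be read off
     [s1]. *)
  transitivity (\sum_(s | fill r s1 S s) lam ^+ #|porbits s| *
     \prod_(x in S) (if x \in s1 @: S then d (crossing r S s x) (nesting r S s x)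
                     else a (crossing r S s x + nesting r S s x)%N) *
     (\prod_(i in S') lo_weight tau i (crossing r' S' s1 i) (nesting r' S' s1 i) * K)).
    apply: eq_bigr => s /fillP[_ off_S]; rewrite s1u; congr (_ * (_ * _)).
    apply: eq_bigr => i iS'; have eqs j : j \in S' -> s j = s1 j.
      by move=> jS'; rewrite off_S // (disjointFl dis).
    congr (lo_weight _ _ _ _); apply: eq_card => j; rewrite [LHS]in_set [RHS]in_set;
      by apply: andb_id2l => jS'; rewrite !eqs.
  rewrite -mulr_suml fill_cyc_sum //; last by move=> x y xS _ _; exact: down.
  (* The cycles complete after the first stage are the fixed points, whose number depends on [tau]
     only. *)
  rewrite (cyc_avoid_fixed r_inj down) s1u -/G -mulrA [_ * K]mulrC !mulrA.
  congr (lam ^+ _ * _ * _ * _).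
  apply: eq_card => i; rewrite !inE.
  have [iS'|iS'] := boolP (i \in S').
    have -> : (s1 i == i) = false by apply/negbTE; rewrite neq_ltn lo.
    by move: iS'; rewrite !inE andbF => /andP[_ /negbTE->].
  have [iS|iS] := boolP (i \in S).
    by move: iS; rewrite !inE => /andP[/negbTE-> /negbTE->].
  rewrite s1f // eqxx andbT.
  by move: iS iS'; rewrite !inE; case: odd; case: (tau i).
rewrite -mulr_sumr fill_sum // s0l -/S'.
rewrite /L -prodr_const /G /K !(big_mkcond (fun i => i \in _)) (big_mkcond (fun i => _ == _)) /=.
rewrite -!big_split; apply: eq_bigr => i _ /=.
rewrite !inE /step_weight /lo_weight !inE.
case ti: (tau i) => [[]|] /=; case oi: (odd i) => /=; rewrite ?mulr1 ?mul1r //.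
- by rewrite covering_lo.
- by rewrite covering_val ?oi.
- by rewrite covering_lo.
- by rewrite covering_drise ?oi.
Qed.

End FixedType.

End Weights.

Lemma sum_option_bool (R : comNzRingType) (F : option bool -> R) :
  \sum_x F x = F (Some true) + F (Some false) + F None.
Proof.
rewrite (bigD1 (Some true)) // (bigD1 (Some false)) // (bigD1 None) //= big_pred0.
  by rewrite addr0 addrA.
by case=> [[]|].
Qed.

(** * Weighted lattice paths with steps of alternating parity *)

Section Paths.

Variables (R : comNzRingType) (lam : R) (a : nat -> R).
Variables (b c d : nat -> nat -> R) (e f : nat -> R).

Let wt := step_weight lam a b c d e f.

(** The test selects the paths from height [k] that end at height 0. A path that would go below 0
    has weight 0, because it takes a peak at height 0. *)
Definition path_sum (m : nat) (p : bool) (k : nat) : R :=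
  \sum_(tau : {ffun 'I_m -> option bool})
    if (k + \sum_(i < m) is_val (p (+) odd i) (tau i) ==
            \sum_(i < m) is_peak (p (+) odd i) (tau i))%N
    then \prod_(i < m) wt (p (+) odd i) (tau i) (height p k tau i) else 0.

Lemma Qhat_path_sum n : Qhat lam a b c d e f n = path_sum (2 * n) false 0.
Proof.
rewrite /Qhat (partition_big (@arc_type (2 * n)%N) predT) //=; apply: eq_bigr => tau _.
rewrite -(type_sum lam a b c d e f tau).
by apply: eq_bigl => s; rewrite -Dperm_arc_type ffunK.
Qed.

Lemma path_sum0 p k : path_sum 0 p k = (k == 0%N)%:R.
Proof.
rewrite /path_sum (big_pred1 [ffun => None]) => [|tau].
  by rewrite !big_ord0 addn0; case: eqP.
by apply/esym/eqP/ffunP => -[].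
Qed.

Let ffun_cons m (x : option bool) (tau : {ffun 'I_m -> option bool}) :
  {ffun 'I_m.+1 -> option bool} := [ffun i => oapp tau x (unlift ord0 i)].

Let ffun_cons0 m x (tau : {ffun 'I_m -> option bool}) : ffun_cons x tau ord0 = x.
Proof. by rewrite ffunE unlift_none. Qed.

Let ffun_consS m x (tau : {ffun 'I_m -> option bool}) i :
  ffun_cons x tau (lift ord0 i) = tau i.
Proof. by rewrite ffunE liftK. Qed.

Lemma path_sumS m p k :
  path_sum m.+1 p k =
  \sum_x wt p x k * path_sum m (~~ p)
    (if is_val p x then k.+1 else if is_peak p x then k.-1 else k).
Proof.
rewrite {1}/path_sum (reindex (fun z => ffun_cons z.1 z.2)) /=; last first.
  exists (fun tau : {ffun 'I_m.+1 -> option bool} => (tau ord0, [ffun i => tau (lift ord0 i)])).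
    move=> [x tau] _ /=; rewrite ffun_cons0; congr (_, _).
    by apply/ffunP => i; rewrite ffunE ffun_consS.
  move=> tau _; apply/ffunP => i; rewrite ffunE.
  by case: unliftP => [j ->|->] //=; rewrite ffunE.
rewrite -(pair_big predT predT (fun x tau => if (k +
       \sum_(i < m.+1) is_val (p (+) odd i) (ffun_cons x tau i) ==
       \sum_(i < m.+1) is_peak (p (+) odd i) (ffun_cons x tau i))%N
    then \prod_(i < m.+1) wt (p (+) odd i) (ffun_cons x tau i)
                           (height p k (ffun_cons x tau) i) else 0)) /=.
apply: eq_bigr => x _; rewrite mulr_sumr; apply: eq_bigr => tau _.
set k' := if is_val p x then _ else _.
rewrite !big_ord_recl !ffun_cons0 /= !addbF.
have h0 : height p k (ffun_cons x tau) 0 = k by rewrite /height !big_pred0 ?addn0 ?subn0.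
rewrite h0.
(* For a peak at height 0 the truncated [k.-1] is not the new height, but the weight vanishes. *)
have [/andP[pk /eqP k0]|ok] := boolP (is_peak p x && (k == 0%N)).
  have -> : wt p x k = 0.
    by move: pk; rewrite /is_peak k0 => /andP[-> /eqP->]; rewrite /wt /= /diag_sum big_ord0.
  by rewrite !mul0r; case: ifP.
have shift V P : (k + (is_val p x + V) - (is_peak p x + P) = k' + V - P)%N /\
    (k + (is_val p x + V) == is_peak p x + P)%N = (k' + V == P)%N.
  move: ok; rewrite /k' /is_val /is_peak; clear; case: p => /=; case: eqP => //= _; lia.
have odd_lift (i : 'I_m) : p (+) odd (lift ord0 i) = ~~ p (+) odd i.
  by rewrite lift0 /= addbN addNb.
under eq_bigr => i _ do rewrite ffun_consS odd_lift.
under [X in _ == (_ + X)%N]eq_bigr => i _ do rewrite ffun_consS odd_lift.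
have hS (i : 'I_m) : height p k (ffun_cons x tau) (lift ord0 i) = height (~~ p) k' tau i.
  have tail (F : bool -> option bool -> bool) :
      (\sum_(j < m.+1 | (j < lift ord0 i)%N) F (p (+) odd j) (ffun_cons x tau j) =
       F p x + \sum_(j < m | (j < i)%N) F (~~ p (+) odd j) (tau j))%N.
    rewrite big_mkcond big_ord_recl; congr (_ + _)%N; first by rewrite /= addbF ffun_cons0.
    rewrite [RHS]big_mkcond; apply: eq_bigr => j _.
    by rewrite ffun_consS odd_lift !lift0 ltnS.
  rewrite /height !tail.
  exact: (shift _ _).1.
have -> : (k + (is_val p x + \sum_(i < m) is_val (~~ p (+) odd i) (tau i)) ==
           is_peak p x + \sum_(i < m) is_peak (~~ p (+) odd i) (tau i))%N =
          (k' + \sum_(i < m) is_val (~~ p (+) odd i) (tau i) ==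
           \sum_(i < m) is_peak (~~ p (+) odd i) (tau i))%N.
  exact: (shift _ _).2.
case: ifP => _; last by rewrite mulr0.
by congr (_ * _); apply: eq_bigr => i _; rewrite ffun_consS odd_lift hS.
Qed.

Lemma path_sum_odd m k : path_sum m.+1 false k =
  (lam + k%:R) * a k * path_sum m true k.+1
  + (lam * f k + diag_sum d k) * path_sum m true k.
Proof.
rewrite path_sumS sum_option_bool /= /is_val /is_peak /= -addrA -mulrDl.
by rewrite [diag_sum d k + _]addrC.
Qed.

Lemma path_sum_even m k : path_sum m.+1 true k =
  diag_sum b k * path_sum m false k.-1
  + (lam * e k + diag_sum c k) * path_sum m false k.
Proof.
rewrite path_sumS sum_option_bool /= /is_val /is_peak /= -addrA -mulrDl.
by rewrite [diag_sum c k + _]addrC.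
Qed.

End Paths.

(** * Power series and tails of the continued fraction *)

Section TFraction.

Variable R : comNzRingType.
Implicit Types u v w : fps R.

(** This transfers associativity from polynomials to power series. *)
Lemma fps_mul_coef u v N n : (n < N)%N ->
  fps_mul u v n = (\poly_(i < N) u i * \poly_(i < N) v i)`_n.
Proof.
move=> ltnN; rewrite coefM; apply: eq_bigr => i _; rewrite !coef_poly.
by rewrite !(leq_trans _ ltnN) // ltnS leq_subr.
Qed.

Lemma fps_mulA u v w n : fps_mul (fps_mul u v) w n = fps_mul u (fps_mul v w) n.
Proof.
pose p u := \poly_(i < n.+1) (u : fps R) i.
transitivity ((p u * p v * p w)`_n).
  rewrite coefM; apply: eq_bigr => i _; rewrite (@fps_mul_coef _ _ n.+1) //.
  by rewrite [in RHS]coef_poly ltnS leq_subr.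
rewrite -mulrA coefM; apply: eq_bigr => i _; rewrite [in LHS]coef_poly ltn_ord.
by rewrite (@fps_mul_coef _ _ n.+1) // ltnS leq_subr.
Qed.

Lemma fps_mulS (x : R) u v n :
  fps_mul (fps_mul (fps_scale x (fps_t R)) u) v n.+1 = x * fps_mul u v n.
Proof.
have xt i : fps_mul (fps_scale x (fps_t R)) u i.+1 = x * u i.
  rewrite /fps_mul big_ord_recl big_ord_recl /fps_scale /fps_t /= big1 => [|j _].
    by rewrite mulr0 mul0r add0r addr0 mulr1 subn1.
  by rewrite mulr0 mul0r.
rewrite {1}/fps_mul big_ord_recl /= {1}/fps_mul big_ord_recl big_ord0 /fps_scale /fps_t /=.
rewrite mulr0 mul0r addr0 mul0r add0r mulr_sumr; apply: eq_bigr => i _.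
by rewrite xt mulrA subSS.
Qed.

Variables delta alpha : nat -> R.

Lemma Tfrac_trunc_coef0 N k : Tfrac_trunc delta alpha N k 0%N = 1.
Proof. by case: N => [|N] /=; rewrite /fps_inv big_ord_recl big_ord0 addr0. Qed.

(** This is the coefficient of [t^(n+1)] in [(1 - delta_k t - alpha_k t T') T = 1]. *)
Lemma Tfrac_trunc_coefS N k n : Tfrac_trunc delta alpha N.+1 k n.+1 =
  delta k * Tfrac_trunc delta alpha N.+1 k n +
  alpha k * fps_mul (Tfrac_trunc delta alpha N k.+1) (Tfrac_trunc delta alpha N.+1 k) n.
Proof.
have := Tfrac_trunc_mul delta alpha N k n.+1.
set T := Tfrac_trunc delta alpha N.+1 k; set T' := Tfrac_trunc delta alpha N k.+1.
rewrite -fps_mulS {1}/fps_mul /fps_sub.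
under eq_bigr => i _ do rewrite !mulrBl.
rewrite !sumrB -!/(fps_mul _ T n.+1).
have -> : fps_mul (fps_one R) T n.+1 = T n.+1.
  rewrite /fps_mul big_ord_recl /fps_one eqxx mul1r subn0 big1 ?addr0 // => i _.
  by rewrite mul0r.
have -> : fps_mul (fps_scale (delta k) (fps_t R)) T n.+1 = delta k * T n.
  rewrite /fps_mul big_ord_recl big_ord_recl /fps_scale /fps_t /= big1 => [|i _].
    by rewrite mulr0 mul0r add0r addr0 mulr1 subn1.
  by rewrite mulr0 mul0r.
by rewrite [fps_one R _]/= /fps_one /= => /eqP; rewrite subr_eq0 subr_eq addrC => /eqP.
Qed.

(** By the recurrence, one more degree costs at most one level of depth. *)
Lemma Tfrac_trunc_stable n N k : (n <= N)%N ->
  Tfrac_trunc delta alpha N k n = Tfrac_trunc delta alpha n k n.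
Proof.
suff H : forall n0, (n0 <= n)%N -> forall N N' k, (n0 <= N)%N -> (n0 <= N')%N ->
    Tfrac_trunc delta alpha N k n0 = Tfrac_trunc delta alpha N' k n0.
  by move=> leN; apply: H.
elim: n {N k} => [|n IH] n0; first by case: n0 => // _ N N' k _ _; rewrite !Tfrac_trunc_coef0.
case: n0 => [_|n0 ltn]; first by apply: IH.
move=> [|N] [|N'] k //; rewrite !ltnS => leN leN'; rewrite !Tfrac_trunc_coefS.
rewrite (IH n0 ltn N.+1 N'.+1 k (leqW leN) (leqW leN')).
congr (_ + _ * _); apply: eq_bigr => i _.
have lei : (i <= n0)%N by rewrite -ltnS.
have le2 : (n0 - i <= n0)%N := leq_subr _ _.
by congr (_ * _); apply: IH; lia.
Qed.

(** The tail of the infinite fraction from level [k] on: depth [n] already gives the stable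
    coefficient of degree [n]. *)
Definition Tfrac_lim (k : nat) : fps R := fun n => Tfrac_trunc delta alpha n k n.

Lemma Tfrac_lim_coefS k n : Tfrac_lim k n.+1 =
  delta k * Tfrac_lim k n + alpha k * fps_mul (Tfrac_lim k.+1) (Tfrac_lim k) n.
Proof.
rewrite {1}/Tfrac_lim Tfrac_trunc_coefS Tfrac_trunc_stable //; congr (_ + _ * _).
apply: eq_bigr => i _; have lei : (i <= n)%N by rewrite -ltnS.
by rewrite !Tfrac_trunc_stable // (leq_trans (leq_subr _ _)).
Qed.

Lemma Tfrac_lim_mul0 k v : fps_mul (Tfrac_lim k) v 0%N = v 0%N.
Proof.
by rewrite /fps_mul big_ord_recl big_ord0 /Tfrac_lim Tfrac_trunc_coef0 mul1r addr0.
Qed.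

(** For [delta k = 0] the tails satisfy [T_k = 1 + alpha_k t T_(k+1) T_k]; multiply by [v]. *)
Lemma Tfrac_lim_mulS k v n : delta k = 0 ->
  fps_mul (Tfrac_lim k) v n.+1 =
  v n.+1 + alpha k * fps_mul (Tfrac_lim k.+1) (fps_mul (Tfrac_lim k) v) n.
Proof.
move=> dk; rewrite -fps_mulA {1}/fps_mul big_ord_recl /Tfrac_lim Tfrac_trunc_coef0 mul1r subn0.
congr (_ + _); rewrite mulr_sumr; apply: eq_bigr => i _.
rewrite -[Tfrac_trunc _ _ _ _ _]/(Tfrac_lim k i.+1) Tfrac_lim_coefS dk mul0r add0r.
by rewrite mulrA.
Qed.

End TFraction.

(** * Solution of the coupled recurrences *)

Theorem theorem4p4 (R : comNzRingType) (lam : R) (a : nat -> R)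
    (b c d : nat -> nat -> R) (e f : nat -> R) (alpha delta : nat -> R)
    (alpha_odd : forall k : nat, (1 <= k)%N ->
       alpha (2 * k - 1)%N =
         (lam + (k - 1)%N%:R) * a (k - 1)%N
         * \sum_(xi < k) b (k - 1 - xi)%N xi)
    (alpha_even : forall k : nat, (1 <= k)%N ->
       alpha (2 * k)%N =
         (lam * e k + \sum_(xi < k) c (k - 1 - xi)%N xi)
         * (lam * f k + \sum_(xi < k) d (k - 1 - xi)%N xi))
    (delta_1 : delta 1%N = lam ^+ 2 * e 0%N * f 0%N)
    (delta_ge2 : forall n : nat, (2 <= n)%N -> delta n = 0) :
  is_Tfrac (Qhat lam a b c d e f) delta alpha.
Proof.
move=> n; exists n => N /Tfrac_trunc_stable ->; rewrite Qhat_path_sum.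
rewrite -[LHS]/(Tfrac_lim delta alpha 1 n).
pose T := Tfrac_lim delta alpha.
pose PS := path_sum lam a b c d e f.
pose up k := (lam + k%:R) * a k.
pose down := diag_sum b.
pose lev_odd k := lam * f k + diag_sum d k.
pose lev_even k := lam * e k + diag_sum c k.
have alpha1 k : alpha k.*2.+1 = up k * down k.+1.
  transitivity (alpha (2 * k.+1 - 1)%N); first by congr alpha; lia.
  by rewrite alpha_odd // /up /down /diag_sum !subn1.
have alpha2 k : alpha k.+1.*2 = lev_even k.+1 * lev_odd k.+1.
  by rewrite -mul2n alpha_even.
(* At height 0 the sums over [c] and [d] are empty, so [delta 1] is the weight of two successive
   fixed points. *)
have delta1 : delta 1%N = lev_odd 0%N * lev_even 0%N.
  by rewrite delta_1 /lev_odd /lev_even /diag_sum !big_ord0 !addr0; ring.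
have PS_odd m k : PS m.+1 false k = up k * PS m true k.+1 + lev_odd k * PS m true k.
  exact: path_sum_odd.
have PS_even m k : PS m.+1 true k = down k * PS m false k.-1 + lev_even k * PS m false k.
  exact: path_sum_even.
(* [Zs k] and [Ys k] are the generating functions of the paths ending at height 0,
   resp. from height k before an odd label and from height k+1 before an even one. *)
pose Yof k (z : fps R) : fps R := fun n => down k.+1 * fps_mul (T k.+1.*2) z n.
pose Zs := fix Zs k : fps R :=
  if k is k'.+1 then
    fun n => if n is n'.+1 then lev_odd k * fps_mul (T k.*2.+1) (Yof k' (Zs k')) n' else 0
  else T 1%N.
pose Ys k := Yof k (Zs k).
have Y0 k : Ys k 0%N = down k.+1 * Zs k 0%N.
  by rewrite /Ys /Yof Tfrac_lim_mul0.
have mulYof k (t : fps R) m :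
    fps_mul t (Yof k (Zs k)) m = down k.+1 * fps_mul t (fps_mul (T k.+1.*2) (Zs k)) m.
  by rewrite mulr_sumr; apply: eq_bigr => i _; rewrite mulrCA.
(* Expand the tail [T k.+1.*2] once: its term 1 gives the peak, the other term the level step. *)
have YZ k m : Ys k m = down k.+1 * Zs k m + lev_even k.+1 * Zs k.+1 m.
  case: m => [|m]; first by rewrite Y0 /= mulr0 addr0.
  rewrite /Ys {1}/Yof Tfrac_lim_mulS ?delta_ge2 // -/T mulrDr; congr (_ + _).
  by rewrite alpha2 /= mulYof; ring.
(* Likewise expand [T k.+1.*2.+1]: its term 1 gives the level step, the other term the valley. *)
have ZSS k m : Zs k.+1 m.+1 = up k.+1 * Ys k.+1 m + lev_odd k.+1 * Ys k m.
  rewrite [LHS]/= -/(Ys k); case: m => [|m].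
    by rewrite Tfrac_lim_mul0 [Ys k.+1 _]Y0 /= !mulr0 add0r.
  rewrite Tfrac_lim_mulS ?delta_ge2 // -/T alpha1 mulrDr addrC; congr (_ + _).
  rewrite -[Ys k.+1 _]/(down k.+2 * fps_mul (T k.+2.*2) (Zs k.+1) m.+1).
  (* [Zs k.+1] has constant coefficient 0, so the last term of the convolution drops out. *)
  have -> : fps_mul (T k.+2.*2) (Zs k.+1) m.+1 =
     lev_odd k.+1 * fps_mul (T k.+1.*2.+2) (fps_mul (T k.+1.*2.+1) (Ys k)) m.
    rewrite {1}/fps_mul big_ord_recr /= subnn /= mulr0 addr0 mulr_sumr.
    apply: eq_bigr => i _; rewrite subSn ?leq_ord // mulrCA.
    by congr (_ * _).
  by ring.
have Z0S m : Zs 0%N m.+1 = up 0%N * Ys 0%N m + lev_odd 0%N * lev_even 0%N * Zs 0%N m.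
  rewrite [LHS]Tfrac_lim_coefS -/T delta1 -[alpha 1%N]/(alpha 0.*2.+1) alpha1 addrC.
  by congr (_ + _); rewrite /Ys /Yof; ring.
have PSY m : (forall k, PS m.*2 false k = Zs k m) -> forall k, PS m.*2.+1 true k.+1 = Ys k m.
  by move=> HZ k; rewrite PS_even !HZ YZ.
suff HZ m : forall k, PS m.*2 false k = Zs k m by rewrite mul2n -[RHS]/(PS n.*2 false 0%N) HZ.
elim: m => [|m IH] k.
  rewrite /PS path_sum0; case: k => [|k] //=.
  by rewrite /T /Tfrac_lim Tfrac_trunc_coef0.
rewrite doubleS PS_odd (PSY _ IH); case: k => [|k]; last by rewrite (PSY _ IH) ZSS.
rewrite PS_even Z0S !IH; congr (_ + _).
(* This removes the spurious peak term that the truncated [0.-1] produces at height 0. *)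
have -> : down 0%N = 0 by rewrite /down /diag_sum big_ord0.
by rewrite mul0r add0r mulrA.
Qed.
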